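(* Let $V=\coprod_{k\in\mathbb{Z}}V_{(k)}$ together with linear maps $\mathcal{Y}(x):V\to(V\otimes V)[[x,x^{-1}]]$ and $c:V\to\mathbb{F}$ satisfy all the axioms of a graded vertex coalgebra except the Jacobi identity. Put $D^*=\mathrm{Res}_x\,x^{-2}(Id_V\otimes c)\mathcal{Y}(x):V\to V$. Suppose that: (i) (weak cocommutativity) for every $v'\in(V^{\otimes3})'$ there exists $k\in\mathbb{Z}_+$ such that for all $v\in V$ $$(x_1-x_2)^k\langle v',(Id_V\otimes\mathcal{Y}(x_2))\mathcal{Y}(x_1)v-(T\otimes Id_V)(Id_V\otimes\mathcal{Y}(x_1))\mathcal{Y}(x_2)v\rangle=0;$$ (ii) ($D^*$-bracket) $\frac{d}{dx}\mathcal{Y}(x)=\mathcal{Y}(x)D^*-(Id_V\otimes D^* )\mathcal{Y}(x)$. Then the Jacobi identity holds: $$x_0^{-1}\delta\left(\tfrac{x_1-x_2}{x_0}\right)(Id_V\otimes\mathcal{Y}(x_2))\mathcal{Y}(x_1)-x_0^{-1}\delta\left(\tfrac{x_2-x_1}{-x_0}\right)(T\otimes Id_V)(Id_V\otimes\mathcal{Y}(x_1))\mathcal{Y}(x_2)=x_2^{-1}\delta\left(\tfrac{x_1-x_0}{x_2}\right)(\mathcal{Y}(x_0)\otimes Id_V)\mathcal{Y}(x_2).$$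
   Context: All vector spaces are over a field $\mathbb{F}$ of characteristic $0$; $x,x_0,x_1,x_2$ are commuting formal variables; $\mathbb{Z}_+$ is the set of positive integers. $\delta(x)=\sum_{n\in\mathbb{Z}}x^n$. For $n\in\mathbb{Z}$, $(x_i\pm x_j)^n$ is expanded in nonnegative integral powers of the second listed variable $x_j$ (this also applies inside $\delta$). $\mathrm{Res}_x$ denotes the coefficient of $x^{-1}$. $W[[x,x^{-1}]]$ is the space of all doubly infinite formal series with coefficients in $W$, and $W((x^{-1}))$ is the space of those with only finitely many positive powers of $x$. $T(u\otimes v)=v\otimes u$ on $V\otimes V$. Linear maps and pairings act on formal series coefficientwise. The axioms of a graded vertex coalgebra other than the Jacobi identity are: $V=\coprod_{k\in\mathbb{Z}}V_{(k)}$ is a $\mathbb{Z}$-graded vector space with $V_{(k)}=0$ for $k$ sufficiently negative; writing $\mathcal{Y}(x)v=\sum_{k\in\mathbb{Z}}\Delta_k(v)x^{-k-1}$, one has $\Delta_k(v)\in(V\otimes V)_{(r+k+1)}$ for all $v\in V_{(r)}$ and $r,k\in\mathbb{Z}$; and for all $v\in V$: 1. Left counit: $(c\otimes Id_V)\mathcal{Y}(x)v=v$. 2. Cocreation: $(Id_V\otimes c)\mathcal{Y}(x)v\in V[[x]]$ and $\lim_{x\to0}(Id_V\otimes c)\mathcal{Y}(x)v=v$. 3. Truncation: $\mathcal{Y}(x)v\in(V\otimes V)((x^{-1}))$. For a graded space $W=\coprod_k W_{(k)}$, the graded dual is $W'=\coprod_k \mathrm{Hom}(W_{(k)},\mathbb{F})$,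 and $\langle\cdot,\cdot\rangle$ is the natural pairing of $W'$ with $W$. $V^{\otimes n}$ is graded by total weight, and $(V^{\otimes n})'$ is its graded dual. *)

(* Defs.v *)
From HB Require Import structures.
From mathcomp Require Import all_boot all_order all_algebra.
From mathcomp Require Import generic_quotient.
From mathcomp Require Import zify.
From mathcomp Require Import boolp classical_sets functions cardinality fsbigop.

Set Implicit Arguments.
Unset Strict Implicit.
Unset Printing Implicit Defensive.

Import GRing.Theory.
Local Open Scope classical_set_scope.
Local Open Scope ring_scope.
Local Open Scope quotient_scope.

(** * Tensor product of two vector spaces of arbitrary dimension *)

Section Tensor.
Variables (F : fieldType) (U V : lmodType F).

(* The sequence [:: (u1, v1); ...; (un, vn)] stands for the formal sum
   u1 (x) v1 + ... + un (x) vn; [tens_eq] is the congruence generated by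
   commutativity of the sum and by bilinearity.  No formal coefficients are
   needed, since a (u (x) v) is (a u) (x) v. *)
Inductive tens_eq : seq (U * V) -> seq (U * V) -> Prop :=
| tens_eq_refl s : tens_eq s s
| tens_eq_sym s t : tens_eq s t -> tens_eq t s
| tens_eq_trans s t r : tens_eq s t -> tens_eq t r -> tens_eq s r
| tens_eq_cat s s' t t' :
    tens_eq s s' -> tens_eq t t' -> tens_eq (s ++ t) (s' ++ t')
| tens_eq_catC s t : tens_eq (s ++ t) (t ++ s)
| tens_eqDl u u' v : tens_eq [:: (u + u', v)] [:: (u, v); (u', v)]
| tens_eqDr u v v' : tens_eq [:: (u, v + v')] [:: (u, v); (u, v')]
| tens_eqZ a u v : tens_eq [:: (a *: u, v)] [:: (u, a *: v)]
| tens_eq0 v : tens_eq [:: (0, v)] [::].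

Definition tens_rel : rel (seq (U * V)) := fun s t => `[< tens_eq s t >].

Lemma tens_rel_refl : reflexive tens_rel.
Proof. by move=> s; apply/asboolP; exact: tens_eq_refl. Qed.

Lemma tens_rel_sym : symmetric tens_rel.
Proof.
by move=> s t; apply/idP/idP => /asboolP h; apply/asboolP; exact: tens_eq_sym.
Qed.

Lemma tens_rel_trans : transitive tens_rel.
Proof.
move=> t s r /asboolP h /asboolP h'; apply/asboolP.
exact: (tens_eq_trans h h').
Qed.

Canonical tens_equiv := EquivRel tens_rel tens_rel_refl tens_rel_sym
  tens_rel_trans.

Definition tensor : Type := {eq_quot tens_equiv}.
HB.instance Definition _ := Choice.on tensor.
HB.instance Definition _ := EqQuotient.on tensor.

Implicit Types (s t : seq (U * V)) (x y z : tensor).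

Lemma tensor_eqP s t : reflect (tens_eq s t) (\pi_tensor s == \pi_tensor t).
Proof. by rewrite eqmodE; exact: asboolP. Qed.

Lemma tensor_pi_eq s t : tens_eq s t -> \pi_tensor s = \pi_tensor t.
Proof. by move=> h; apply/eqP/tensor_eqP. Qed.

Lemma tens_eq_repr s : tens_eq (repr (\pi_tensor s)) s.
Proof. by apply/tensor_eqP; rewrite reprK. Qed.

Definition tscale_seq (a : F) s := [seq (a *: p.1, p.2) | p <- s].

Lemma tscale_seq_eq a s t :
  tens_eq s t -> tens_eq (tscale_seq a s) (tscale_seq a t).
Proof.
elim=> {s t} [s|s t _ h|s t r _ h1 _ h2|s s' t t' _ h1 _ h2|s t|u u' v|u v v'
  |b u v|v] /=.
- exact: tens_eq_refl.
- exact: tens_eq_sym.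
- exact: tens_eq_trans h1 h2.
- by rewrite /tscale_seq !map_cat; exact: tens_eq_cat.
- by rewrite /tscale_seq !map_cat; exact: tens_eq_catC.
- by rewrite scalerDr; exact: tens_eqDl.
- exact: tens_eqDr.
- by rewrite scalerA mulrC -scalerA; exact: tens_eqZ.
- by rewrite scaler0; exact: tens_eq0.
Qed.

Definition tzero : tensor := \pi_tensor [::].
Definition tadd x y : tensor := \pi_tensor (repr x ++ repr y).
Definition tscale a x : tensor := \pi_tensor (tscale_seq a (repr x)).
Definition topp x : tensor := tscale (-1) x.

Lemma tadd_pi s t : tadd (\pi_tensor s) (\pi_tensor t) = \pi_tensor (s ++ t).
Proof. by apply: tensor_pi_eq; apply: tens_eq_cat; exact: tens_eq_repr. Qed.

Lemma tscale_pi a s : tscale a (\pi_tensor s) = \pi_tensor (tscale_seq a s).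
Proof. by apply: tensor_pi_eq; apply: tscale_seq_eq; exact: tens_eq_repr. Qed.

Lemma tens_eqN s : tens_eq (tscale_seq (-1) s ++ s) [::].
Proof.
elim: s => [|[u v] s ih] /=; first exact: tens_eq_refl.
apply: tens_eq_trans (_ : tens_eq _
  ([:: (-1 *: u, v)] ++ ([:: (u, v)] ++ s ++ tscale_seq (-1) s))) _.
  apply: (@tens_eq_cat [:: _] [:: _]); first exact: tens_eq_refl.
  exact: (tens_eq_catC _ ((u, v) :: s)).
apply: (@tens_eq_cat [:: _; _] [::] (_ ++ _) [::]).
  apply: tens_eq_trans (tens_eq0 v); apply: tens_eq_sym.
  by rewrite -(addNr u) -(scaleN1r u) /=; exact: tens_eqDl.
exact: tens_eq_trans (tens_eq_catC _ _) ih.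
Qed.

Lemma taddA : associative tadd.
Proof.
move=> x y z; elim/quotW: x => s; elim/quotW: y => t; elim/quotW: z => r.
by rewrite (tadd_pi t r) (tadd_pi s t) !tadd_pi catA.
Qed.

Lemma taddC : commutative tadd.
Proof.
move=> x y; elim/quotW: x => s; elim/quotW: y => t.
rewrite !tadd_pi; apply: tensor_pi_eq.
exact: tens_eq_catC.
Qed.

Lemma tadd0 : left_id tzero tadd.
Proof. by move=> x; elim/quotW: x => s; rewrite tadd_pi. Qed.

Lemma taddN : left_inverse tzero topp tadd.
Proof.
move=> x; elim/quotW: x => s; rewrite /topp tscale_pi tadd_pi.
apply: tensor_pi_eq.
exact: tens_eqN.
Qed.

HB.instance Definition _ :=
  GRing.isZmodule.Build tensor taddA taddC tadd0 taddN.

Lemma tscaleA a b x : tscale a (tscale b x) = tscale (a * b) x.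
Proof.
elim/quotW: x => s; rewrite (tscale_pi b) !tscale_pi; congr (\pi_tensor _).
by rewrite /tscale_seq -map_comp; apply: eq_map => p /=; rewrite scalerA.
Qed.

Lemma tscale1 : left_id 1 tscale.
Proof.
move=> x; elim/quotW: x => s; rewrite tscale_pi; congr (\pi_tensor _).
by rewrite -[RHS]map_id; apply: eq_map => -[u v] /=; rewrite scale1r.
Qed.

Lemma tscaleDr : right_distributive tscale +%R.
Proof.
move=> a x y; elim/quotW: x => s; elim/quotW: y => t.
by rewrite [_ + _]tadd_pi !tscale_pi [RHS]tadd_pi /tscale_seq map_cat.
Qed.

Lemma tscaleDl x : {morph tscale^~ x : a b / a + b}.
Proof.
move=> a b; elim/quotW: x => s; rewrite !tscale_pi [RHS]tadd_pi.
apply: tensor_pi_eq; elim: s => [|[u v] s ih] /=; first exact: tens_eq_refl.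
apply: tens_eq_trans (_ : tens_eq _ ([:: (a *: u, v); (b *: u, v)] ++
  (tscale_seq a s ++ tscale_seq b s))) _.
  apply: (@tens_eq_cat [:: _] _) ih; rewrite scalerDl; exact: tens_eqDl.
apply: (@tens_eq_cat [:: _] [:: _] (_ :: _)); first exact: tens_eq_refl.
rewrite -cat1s -[X in tens_eq _ (_ ++ X)]cat1s !catA.
apply: tens_eq_cat; last exact: tens_eq_refl.
exact: tens_eq_catC.
Qed.

HB.instance Definition _ :=
  GRing.Zmodule_isLmodule.Build F tensor tscaleA tscale1 tscaleDr tscaleDl.

Definition tens (u : U) (v : V) : tensor := \pi_tensor [:: (u, v)].

Lemma tensDl u u' v : tens (u + u') v = tens u v + tens u' v.
Proof.
by rewrite [RHS]tadd_pi; apply: tensor_pi_eq; exact: tens_eqDl.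
Qed.

Lemma tensDr u v v' : tens u (v + v') = tens u v + tens u v'.
Proof.
by rewrite [RHS]tadd_pi; apply: tensor_pi_eq; exact: tens_eqDr.
Qed.

Lemma tensZl a u v : tens (a *: u) v = a *: tens u v.
Proof. by rewrite [RHS]tscale_pi. Qed.

Lemma tensZr a u v : tens u (a *: v) = a *: tens u v.
Proof.
by rewrite -tensZl; apply: tensor_pi_eq; apply: tens_eq_sym; exact: tens_eqZ.
Qed.

Lemma tensor_piE s : \pi_tensor s = \sum_(p <- s) tens p.1 p.2.
Proof.
elim: s => [|[u v] s ih]; first by rewrite big_nil.
by rewrite big_cons -ih [RHS]tadd_pi.
Qed.

Lemma tensor_reprE x : x = \sum_(p <- repr x) tens p.1 p.2.
Proof. by rewrite -tensor_piE reprK. Qed.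

(** ** Universal property *)

Definition is_bilinear (W : lmodType F) (b : U -> V -> W) : Prop :=
  (forall v, linear (b^~ v)) /\ (forall u, linear (b u)).

Section Lift.
Variables (W : lmodType F) (b : U -> V -> W) (b_bilin : is_bilinear b).

Definition tlift of is_bilinear b : tensor -> W :=
  fun x => \sum_(p <- repr x) b p.1 p.2.

Local Notation lift := (tlift b_bilin).

Lemma tens_eq_sum s t : tens_eq s t ->
  \sum_(p <- s) b p.1 p.2 = \sum_(p <- t) b p.1 p.2.
Proof.
have [bl br] := b_bilin.
have bl0 v : b 0 v = 0.
  by have := bl v (-1) 0 0; rewrite scaler0 addr0 scaleN1r addNr.
have br0 u : b u 0 = 0.
  by have := br u (-1) 0 0; rewrite scaler0 addr0 scaleN1r addNr.
elim=> {s t} [s|s t _ ->|s t r _ -> _ ->|s s' t t' _ h1 _ h2|s t|u u' v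
  |u v v'|a u v|v] //=.
- by rewrite !big_cat /= h1 h2.
- by rewrite !big_cat /= addrC.
- by rewrite !big_cons !big_nil !addr0 -[X in X + u']scale1r bl scale1r.
- by rewrite !big_cons !big_nil !addr0 -[X in X + v']scale1r br scale1r.
- rewrite !big_seq1 /=; have := bl v a u 0; have := br u a v 0.
  by rewrite !addr0 bl0 br0 !addr0 => -> ->.
- by rewrite big_seq1 big_nil.
Qed.

Lemma tlift_pi s : lift (\pi_tensor s) = \sum_(p <- s) b p.1 p.2.
Proof. exact: tens_eq_sum (tens_eq_repr s). Qed.

Lemma tlift_tens u v : lift (tens u v) = b u v.
Proof. by rewrite tlift_pi big_seq1. Qed.

Lemma tlift_is_linear : linear lift.
Proof.
move=> a x y; elim/quotW: x => s; elim/quotW: y => t.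
have -> : a *: \pi_tensor s + \pi_tensor t =
  \pi_tensor (tscale_seq a s ++ t).
  by rewrite [a *: _]tscale_pi [LHS]tadd_pi.
rewrite !tlift_pi big_cat /=; congr (_ + _).
rewrite big_map scaler_sumr; apply: eq_bigr => -[u v] _ /=.
have := tens_eq_sum (tens_eq0 v); rewrite big_seq1 big_nil /= => b0.
by have := b_bilin.1 v a u 0; rewrite !addr0 b0 addr0.
Qed.

HB.instance Definition _ :=
  GRing.isLinear.Build F tensor W *:%R (tlift b_bilin) tlift_is_linear.

End Lift.

Lemma tlift_unique (W : lmodType F) (f g : {linear tensor -> W}) :
  (forall u v, f (tens u v) = g (tens u v)) -> f =1 g.
Proof.
move=> fg x; rewrite (tensor_reprE x) !linear_sum /=.
by apply: eq_bigr => p _; exact: fg.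
Qed.

Lemma tens_is_bilinear : is_bilinear tens.
Proof.
by split=> [v a u u'|u a v v'];
  rewrite ?tensDl ?tensDr ?tensZl ?tensZr.
Qed.

End Tensor.

Section TensorMaps.
Variable F : fieldType.
Implicit Types U V W : lmodType F.

Lemma tmap_is_bilinear U V U' V' (f : {linear U -> U'}) (g : {linear V -> V'}) :
  is_bilinear (fun u v => tens (f u) (g v)).
Proof.
by split=> [v a u u'|u a v v']; rewrite linearP ?tensDl ?tensDr ?tensZl ?tensZr.
Qed.

Definition tmap U V U' V' (f : {linear U -> U'}) (g : {linear V -> V'}) :
  {linear tensor U V -> tensor U' V'} := tlift (tmap_is_bilinear f g).

Lemma tmapE U V U' V' (f : {linear U -> U'}) (g : {linear V -> V'}) u v :
  tmap f g (tens u v) = tens (f u) (g v).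
Proof. exact: tlift_tens. Qed.

Lemma tflip_is_bilinear V : is_bilinear (fun u v : V => tens v u).
Proof. by have [bl br] := tens_is_bilinear V V; split. Qed.

Definition tflip V : {linear tensor V V -> tensor V V} :=
  tlift (@tflip_is_bilinear V).

Lemma tflipE V (u v : V) : tflip V (tens u v) = tens v u.
Proof. exact: tlift_tens. Qed.

Lemma tassoc_is_bilinear1 U V W (u : U) :
  is_bilinear (fun (v : V) (w : W) => tens (tens u v) w).
Proof.
by split=> [w a v v'|v a w w']; rewrite ?tensDr ?tensZr ?tensDl ?tensZl.
Qed.

Lemma tassoc_is_bilinear U V W :
  is_bilinear (fun u => tlift (@tassoc_is_bilinear1 U V W u)).
Proof.
split=> [t a u u'|u]; last exact: linearP.
elim/quotW: t => s; rewrite !tlift_pi scaler_sumr -big_split /=.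
by apply: eq_bigr => p _; rewrite !tensDl !tensZl.
Qed.

(* u (x) (v (x) w) |-> (u (x) v) (x) w *)
Definition tassoc U V W :
    {linear tensor U (tensor V W) -> tensor (tensor U V) W} :=
  tlift (tassoc_is_bilinear U V W).

Lemma tassocE U V W (u : U) (v : V) (w : W) :
  tassoc U V W (tens u (tens v w)) = tens (tens u v) w.
Proof. by rewrite /tassoc /= !tlift_tens. Qed.

Lemma tlunit_is_bilinear V : is_bilinear (fun (a : F^o) (v : V) => a *: v).
Proof.
split=> [v k a b|a k u v]; first by rewrite scalerDl -scalerA.
by rewrite scalerDr !scalerA mulrC.
Qed.

(* the canonical isomorphisms of F (x) V and V (x) F with V *)
Definition tlunit V : {linear tensor F^o V -> V} :=
  tlift (tlunit_is_bilinear V).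

Lemma trunit_is_bilinear V : is_bilinear (fun (v : V) (a : F^o) => a *: v).
Proof.
by have [bl br] := tlunit_is_bilinear V; split.
Qed.

Definition trunit V : {linear tensor V F^o -> V} :=
  tlift (trunit_is_bilinear V).

End TensorMaps.

(** * Formal series

   A formal series in n variables with coefficients in W, infinite in both
   directions, is a function from its exponents (in int, int * int or
   int * int * int) to W. *)

Section Series.
Variable F : fieldType.
Variable W : lmodType F.

Definition xshift (k : int) (s : int -> W) : int -> W := fun n => s (n - k).
Definition fres (s : int -> W) : W := s (- 1).
Definition fderiv (s : int -> W) : int -> W :=
  fun n => (n + 1)%:~R *: s (n + 1).

Definition cauchy_summable (E : zmodType) (d : E -> F) (A : E -> W) : Prop :=
  forall n : E, finite_set [set e | d e *: A (n - e) != 0].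

(* Meaningful only if [cauchy_summable d A]: a sum with infinite support is 0
   by convention. *)
Definition cauchy_mul (E : zmodType) (d : E -> F) (A : E -> W) : E -> W :=
  fun n => \sum_(e \in [set: E]) d e *: A (n - e).

(* series in (x1, x2), resp. (x0, x2), seen as series in (x0, x1, x2) *)
Definition embed12 (A : int * int -> W) : int * int * int -> W :=
  fun '(n0, n1, n2) => if n0 == 0 then A (n1, n2) else 0.
Definition embed02 (A : int * int -> W) : int * int * int -> W :=
  fun '(n0, n1, n2) => if n1 == 0 then A (n0, n2) else 0.

End Series.

Section Delta.
Variable F : fieldType.

(* generalized binomial coefficient n (n - 1) ... (n - i + 1) / i! *)
Definition gbinom (n : int) (i : nat) : F :=
  (\prod_(j < i) (n%:~R - j%:R)) / (i`!)%:R.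

(* (xi - xj)^n, as a series in (xi, xj), expanded in nonnegative powers
   of xj *)
Definition sub_pow (n : int) : int * int -> F := fun '(a, b) =>
  if b is Posz i then
    if a + b == n then (-1) ^+ i * gbinom n i else 0
  else 0.

(* delta((xi - xj) / xk) = sum_n (xi - xj)^n xk^(-n), as a series in
   (xi, xj, xk) *)
Definition delta_sub : int * int * int -> F := fun '(a, b, c) =>
  sub_pow (- c) (a, b).

(* delta((xi - xj) / (- xk)) *)
Definition delta_subN : int * int * int -> F := fun '(a, b, c) =>
  (-1) ^ c * sub_pow (- c) (a, b).

(* The three delta series of the Jacobi identity, in (x0, x1, x2); the factor
   xk^-1 shifts the exponent of xk. *)

(* x0^-1 delta((x1 - x2) / x0) *)
Definition delta_12_0 : int * int * int -> F := fun '(n0, n1, n2) =>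
  delta_sub (n1, n2, n0 + 1).
(* x0^-1 delta((x2 - x1) / (- x0)) *)
Definition delta_21_N0 : int * int * int -> F := fun '(n0, n1, n2) =>
  delta_subN (n2, n1, n0 + 1).
(* x2^-1 delta((x1 - x0) / x2) *)
Definition delta_10_2 : int * int * int -> F := fun '(n0, n1, n2) =>
  delta_sub (n1, n0, n2 + 1).

End Delta.

(** * Graded spaces *)

Section Graded.
Variable F : fieldType.
Implicit Types U V W : lmodType F.

Record is_grading W (gr : int -> set W) : Prop := IsGrading {
  grading0 : forall k, gr k 0;
  grading_linear : forall k a u v, gr k u -> gr k v -> gr k (a *: u + v);
  grading_decomp : forall w, exists! f : int -> W,
    [/\ forall k, gr k (f k), finite_set [set k | f k != 0]
      & w = \sum_(k \in [set: int]) f k] }.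

(* total weight: the span of the u (x) v with u in U_(i), v in V_(j) and
   i + j = n *)
Definition tensor_grading U V (grU : int -> set U) (grV : int -> set V) :
    int -> set (tensor U V) := fun n =>
  [set t | exists2 s : seq (U * V), t = \sum_(p <- s) tens p.1 p.2 &
     forall p, p \in s ->
       exists i j, [/\ grU i p.1, grV j p.2 & i + j = n]].

(* An element of the coproduct of the Hom(W_(k), F) is a linear form on W
   that vanishes on all but finitely many W_(k). *)
Definition graded_dual W (gr : int -> set W) : set {linear W -> F^o} :=
  [set f | finite_set [set k | exists2 w, gr k w & f w != 0]].

End Graded.

(** * Graded vertex coalgebras *)

Section VertexCoalgebra.
Variables (F : fieldType) (V : lmodType F).
Variables (Y : {linear V -> (int -> tensor V V)}) (c : {linear V -> F^o}).

(* the coefficient of x^n in Y(x) *)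
Definition Ycoef (n : int) : V -> tensor V V := fun v => Y v n.

Lemma Ycoef_is_linear n : linear (Ycoef n).
Proof. by move=> a u v; rewrite /Ycoef linearP. Qed.

HB.instance Definition _ n :=
  GRing.isLinear.Build F V (tensor V V) *:%R (Ycoef n) (Ycoef_is_linear n).

Definition Delta (k : int) (v : V) : tensor V V := Ycoef (- k - 1) v.

(* c (x) Id and Id (x) c, with values in V *)
Definition counitl (t : tensor V V) : V := tlunit V (tmap c idfun t).
Definition counitr (t : tensor V V) : V := trunit V (tmap idfun c t).

Definition Dstar (v : V) : V := fres (xshift (-2) (counitr \o Y v)).

Lemma Dstar_is_linear : linear Dstar.
Proof.
by move=> a u v; rewrite /Dstar /fres /xshift /counitr /= [Y _]linearP !linearP.
Qed.

HB.instance Definition _ :=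
  GRing.isLinear.Build F V V *:%R Dstar Dstar_is_linear.

Record graded_vertex_coalgebra_but_jacobi (gr : int -> set V) : Prop := {
  gvc_grading : is_grading gr;
  gvc_bounded_below : exists N : int, forall k, k < N ->
    forall v, gr k v -> v = 0;
  gvc_weight : forall r k v, gr r v ->
    tensor_grading gr gr (r + k + 1) (Delta k v);
  gvc_counit : forall v n, counitl (Y v n) = if n == 0 then v else 0;
  gvc_cocreation_reg : forall v n, n < 0 -> counitr (Y v n) = 0;
  gvc_cocreation_lim : forall v, counitr (Y v 0) = v;
  gvc_truncation : forall v, exists N : int, forall n, N < n -> Y v n = 0 }.

Local Notation V3 := (tensor (tensor V V) V).

Definition V3_grading (gr : int -> set V) : int -> set V3 :=
  tensor_grading (tensor_grading gr gr) gr.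

(* (Id (x) Y(x2)) Y(x1) v, in (x1, x2) *)
Definition Y_right (v : V) : int * int -> V3 := fun '(n1, n2) =>
  tassoc V V V (tmap idfun (Ycoef n2) (Ycoef n1 v)).

(* (T (x) Id) (Id (x) Y(x1)) Y(x2) v, in (x1, x2) *)
Definition Y_right_flip (v : V) : int * int -> V3 := fun '(n1, n2) =>
  tmap (tflip V) idfun (tassoc V V V (tmap idfun (Ycoef n1) (Ycoef n2 v))).

(* (Y(x0) (x) Id) Y(x2) v, in (x0, x2) *)
Definition Y_left (v : V) : int * int -> V3 := fun '(n0, n2) =>
  tmap (Ycoef n0) idfun (Ycoef n2 v).

Definition weak_cocommutativity (gr : int -> set V) : Prop :=
  forall v' : {linear V3 -> F^o}, graded_dual (V3_grading gr) v' ->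
  exists2 k : nat, (0 < k)%N &
  forall v, cauchy_mul (sub_pow F k%:Z)
    (fun e => v' (Y_right v e - Y_right_flip v e)) = (fun=> 0).

Definition Dstar_bracket : Prop := forall v,
  fderiv (Y v) = Y (Dstar v) - (fun n => tmap idfun Dstar (Y v n)).

Definition jacobi_identity : Prop := forall v,
  cauchy_mul (delta_12_0 F) (embed12 (Y_right v))
  - cauchy_mul (delta_21_N0 F) (embed12 (Y_right_flip v))
  = cauchy_mul (delta_10_2 F) (embed02 (Y_left v)).

(** All the products above are well defined. *)

Lemma finite_exponents (E : Type) (f : nat -> E) (K : nat) (S : set E) :
  (forall e, S e -> exists2 i, (i < K)%N & e = f i) -> finite_set S.
Proof.
move=> h; apply: (@sub_finite_set _ _ (f @` `I_K)); last first.
  exact/finite_image/finite_II.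
by move=> e /h [i iK ->]; exists i.
Qed.

Lemma cauchy_supp (W : lmodType F) (E : zmodType) (d : E -> F) (A : E -> W)
    n e :
  [set e | d e *: A (n - e) != 0] e -> d e != 0 /\ A (n - e) != 0.
Proof.
move=> /= h; split; first by apply: contraNneq h => ->; rewrite scale0r.
by apply: contraNneq h => ->; rewrite scaler0.
Qed.

Lemma sub_pow_neq0 n a b : sub_pow F n (a, b) != 0 ->
  exists2 i : nat, b = i & a = n - i%:Z.
Proof.
rewrite /sub_pow; case: b => [i|i]; last by rewrite eqxx.
have [<- _|_] := eqVneq (a + i%:Z) n; last by rewrite eqxx.
by exists i; rewrite ?addrK.
Qed.

Lemma summable_weak_cocommutativity (W : lmodType F) (k : nat)
  (A : int * int -> W) : cauchy_summable (sub_pow F k%:Z) A.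
Proof.
move=> n; apply: (@finite_exponents _
  (fun i : nat => (k%:Z - i%:Z, i%:Z)) k.+1).
move=> [a b] /cauchy_supp [d0 _].
have [i eb ea] := sub_pow_neq0 d0; exists i; last by rewrite eb ea.
rewrite ltnS leqNgt; apply: contraNN d0 => ki.
rewrite eb ea /sub_pow subrK eqxx /gbinom.
by rewrite (bigD1 (Ordinal ki)) //= subrr !mul0r mulr0.
Qed.

Section Summable.
Variable v : V.
Hypothesis Ytrunc : exists N : int, forall n, N < n -> Y v n = 0.

Lemma summable_12_0 :
  cauchy_summable (delta_12_0 F) (embed12 (Y_right v)).
Proof.
have [N hN] := Ytrunc; move=> [[m0 m1] m2].
apply: (@finite_exponents (int * int * int)
  (fun i : nat => (m0, - (m0 + 1) - i%:Z, i%:Z)) (absz (N - m0 - m1)%R).+1).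
move=> [[e0 e1] e2] /cauchy_supp [].
move=> /sub_pow_neq0 [i -> ->] /=.
have [e|_] := eqVneq (m0 - e0) 0; last by rewrite eqxx.
have -> : e0 = m0 by apply/esym/eqP; rewrite -subr_eq0 e.
move=> A0; exists i => //; rewrite ltnNge; apply: contraNN A0 => Ki.
by rewrite /Ycoef hN ?linear0 //; lia.
Qed.

Lemma summable_21_N0 :
  cauchy_summable (delta_21_N0 F) (embed12 (Y_right_flip v)).
Proof.
have [N hN] := Ytrunc; move=> [[m0 m1] m2].
apply: (@finite_exponents (int * int * int)
  (fun i : nat => (m0, i%:Z, - (m0 + 1) - i%:Z)) (absz (N - m0 - m2)%R).+1).
move=> [[e0 e1] e2] /cauchy_supp [].
rewrite /= mulf_eq0 => /norP[_].
move=> /sub_pow_neq0 [i -> ->] /=.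
have [e|_] := eqVneq (m0 - e0) 0; last by rewrite eqxx.
have -> : e0 = m0 by apply/esym/eqP; rewrite -subr_eq0 e.
move=> A0; exists i => //; rewrite ltnNge; apply: contraNN A0 => Ki.
by rewrite /Ycoef hN ?linear0 //; lia.
Qed.

Lemma summable_10_2 :
  cauchy_summable (delta_10_2 F) (embed02 (Y_left v)).
Proof.
have [N hN] := Ytrunc; move=> [[m0 m1] m2].
apply: (@finite_exponents (int * int * int)
  (fun i : nat => (i%:Z, m1, - 1 - m1 - i%:Z)) (absz (N - m1 - m2)%R).+1).
move=> [[e0 e1] e2] /cauchy_supp [].
move=> /sub_pow_neq0 [i -> e1E] /=.
have [e|_] := eqVneq (m1 - e1) 0; last by rewrite eqxx.
have e1m : e1 = m1 by apply/esym/eqP; rewrite -subr_eq0 e.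
have e2E : e2 = - 1 - m1 - i%:Z by lia.
move=> A0; exists i; last by rewrite e1m e2E.
rewrite ltnNge; apply: contraNN A0 => Ki.
by rewrite /Ycoef hN ?linear0 //; lia.
Qed.

End Summable.

End VertexCoalgebra.

(* Main.v *)
Require Import Defs.
From HB Require Import structures.
From mathcomp Require Import all_boot all_order all_algebra.
From mathcomp Require Import finmap zify ring.
From mathcomp Require Import boolp classical_sets functions cardinality fsbigop.

(** The graded dual U of V is a vertex algebra: the product a_n b of two graded
    functionals is the functional (a (x) b) o Delta_n, the vacuum is the
    counit, and the derivation D is the transpose of D^*.  Weights bounded
    below give a_n b = 0 for n large; weak cocommutativity and the D^*-bracket
    become weak commutativity and the D-bracket.  Functionals a (x) b (x) w
    with graded a, b, w separate the points of V (x) V (x) V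
    ([graded_dual_separating], [separating_tensor]), so the Jacobi identity of
    V is equivalent to the one of U, whose coefficients are the Borcherds
    identities

      sum_i C(m,i) (a_(l+i) b)_(m+n-i) w
        = sum_i (-1)^i C(l,i) a_(m+l-i) (b_(n+i) w)
          - (-1)^l sum_i (-1)^i C(l,i) b_(n+l-i) (a_(m+i) w).

    Everything on the vertex algebra side rests on one remark: by Pascal's
    rule each of the three sums X(l,m,n) satisfies
    X(l+1,m,n) = X(l,m+1,n) - X(l,m,n+1), which expresses x0 = x1 - x2.  A
    solution that vanishes for l large and for m large is zero
    ([jacobi_rec_eq0_corner]).  The defect of the Borcherds identity is a
    solution; it vanishes for l large by weak commutativity of a and b on w.
    It vanishes for m large if the first sum then equals the second one
    ([associativity]).  That follows from weak commutativity of a and w on b,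
    transported by skew symmetry Y(a,x)b = e^(xD) Y(b,-x)a of the pairs (b,w)
    and (a_l b, w); the transport is again a comparison of solutions of the
    recursion, which reduces it to one value of l or of m.

    Skew symmetry is obtained from the same argument.  With w the vacuum it
    reads Y(b,x)1 = e^(xD) b, a consequence of the D-bracket and creation; so
    the Borcherds identity holds for (a, b, 1), and its coefficient
    (l, -1, 0) is skew symmetry of b and a.  Hence the Borcherds identity holds
    for all (a, b, w).  The exponent in weak commutativity may depend on
    all three of a, b and w, as it does here, since each triple is treated
    separately. *)

Set Implicit Arguments.
Unset Strict Implicit.
Unset Printing Implicit Defensive.

Import Order.TTheory GRing.Theory Num.Theory.
Local Open Scope classical_set_scope.
Local Open Scope ring_scope.

(** * Induction on integers and generalized binomial coefficients *)

Lemma int_ind_down (P : int -> Prop) (N : int) :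
  (forall n, N <= n -> P n) -> (forall n, P (n + 1) -> P n) -> forall n, P n.
Proof.
move=> Pbig Pdown n; have [|nN] := leP N n; first exact: Pbig.
have -> : n = N - (absz (N - n))%:Z by lia.
elim: (absz _) => [|i ih]; first by apply: Pbig; lia.
by apply: Pdown; rewrite (_ : _ + 1 = N - i%:Z) //; lia.
Qed.

Lemma int_ind_both (P : int -> Prop) :
  P 0 -> (forall n, P n -> P (n + 1)) -> (forall n, P (n + 1) -> P n) ->
  forall n, P n.
Proof.
move=> P0 Pup Pdown; apply: (@int_ind_down P 0) => // -[i|//] _.
elim: i => // i ih; have := Pup _ ih; by rewrite -PoszD addn1.
Qed.

Section GeneralizedBinomial.
Variable F : fieldType.
Hypothesis charF : [pchar F] =i pred0.

Local Notation C := (gbinom F).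

Lemma natr_neq0 n : n.+1%:R != 0 :> F.
Proof. by have /pcharf0P -> := charF. Qed.

Lemma fact_neq0 n : n`!%:R != 0 :> F.
Proof. by have /pcharf0P -> := charF; rewrite -lt0n fact_gt0. Qed.

Lemma gbinom0 x : C x 0 = 1.
Proof. by rewrite /gbinom big_ord0 fact0 divr1. Qed.

Lemma gbinom_mulS x i : i.+1%:R * C x i.+1 = (x%:~R - i%:R) * C x i.
Proof.
rewrite /gbinom big_ord_recr /= factS natrM.
have := fact_neq0 i; have := natr_neq0 i; move: (\prod_(_ < _) _) => P.
by move=> h1 h2; field; rewrite nat1r h1 h2.
Qed.

(** Absorption: it rewrites the factor n of the D-bracket. *)
Lemma gbinom_absorb x i : i.+1%:R * C x i.+1 = x%:~R * C (x - 1) i.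
Proof.
rewrite /gbinom big_ord_recl /= subr0 factS natrM.
have -> : \prod_(j < i) (x%:~R - (bump 0 j)%:R) =
  \prod_(j < i) ((x - 1)%:~R - j%:R) :> F.
  apply: eq_bigr => j _; rewrite /bump /= natrD intrB; ring.
have := fact_neq0 i; have := natr_neq0 i; move: (\prod_(_ < _) _) => P.
by move=> h1 h2; field; rewrite nat1r h1 h2.
Qed.

Lemma gbinomS x i : C (x + 1) i.+1 = C x i.+1 + C x i.
Proof.
apply: (mulfI (natr_neq0 i)); rewrite mulrDr gbinom_absorb addrK gbinom_mulS.
by rewrite intrD -mulrDl -natr1; congr (_ * _); ring.
Qed.

Lemma gbinom0S i : C 0 i.+1 = 0.
Proof. by rewrite /gbinom big_ord_recl /= subrr !mul0r. Qed.

Lemma gbinomN1 i : C (-1) i = (-1) ^+ i.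
Proof.
elim: i => [|i ih]; first by rewrite gbinom0.
apply: (mulfI (natr_neq0 i)); rewrite gbinom_mulS ih exprS -natr1 intrN.
by ring.
Qed.

(** Upper negation: it turns the coefficients of the delta series attached to
    the iterate into those of x1^m = (x2 + x0)^m. *)
Lemma gbinomN x i : (-1) ^+ i * C (i%:Z - 1 - x) i = C x i.
Proof.
rewrite /gbinom mulrA; congr (_ / _).
rewrite -{1}(card_ord i) -prodr_const -big_split /=.
rewrite (reindex_inj rev_ord_inj); apply: eq_bigr => -[j ji] _ /=.
rewrite natrB // -natr1 !intrB -pmulrn; ring.
Qed.

Lemma gbinom_nat (k i : nat) : C k%:Z i = 'C(k, i)%:R.
Proof.
elim: k i => [|k ih] [|i]; rewrite ?gbinom0 ?gbinom0S ?bin0 //.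
by rewrite -addn1 PoszD gbinomS // !ih addn1 binS natrD addrC.
Qed.

End GeneralizedBinomial.

(** * The three sums of the Jacobi identity *)

Section JacobiSums.
Variables (F : fieldType) (U : lmodType F).
Hypothesis charF : [pchar F] =i pred0.

Definition finsum (g : nat -> U) : U := \sum_(i \in [set: nat]) g i.

Lemma finsumE N g :
  (forall i, (N <= i)%N -> g i = 0) -> finsum g = \sum_(i < N) g i.
Proof.
move=> g0; rewrite fsbig_ord /finsum; apply/esym/fsbig_widen => // i /= [_].
by move=> /negP; rewrite -leqNgt; exact: g0.
Qed.

Lemma eq_finsum g h : g =1 h -> finsum g = finsum h.
Proof. by move=> /funext ->. Qed.

(** Pairs g with the expansion of a binomial power (1 + z)^x. *)
Definition bsum (x : int) (g : nat -> U) : U :=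
  finsum (fun i => gbinom F x i *: g i).

Lemma bsumE N x g : (forall i, (N <= i)%N -> g i = 0) ->
  bsum x g = \sum_(i < N) gbinom F x i *: g i.
Proof. by move=> g0; apply: finsumE => i /g0 ->; rewrite scaler0. Qed.

Lemma bsum0 g : bsum 0 g = g 0%N.
Proof.
rewrite /bsum (@finsumE 1) ?big_ord1 ?gbinom0 ?scale1r // => -[//|i] _.
by rewrite gbinom0S scale0r.
Qed.

(** Pascal's rule; the three recursions below are instances of it. *)
Lemma bsumS N x g : (forall i, (N <= i)%N -> g i = 0) ->
  bsum (x + 1) g = bsum x g + bsum x (fun i => g i.+1).
Proof.
move=> g0; have g0' i : (N.+1 <= i)%N -> g i = 0 by move=> /ltnW; exact: g0.
have gS i : (N <= i)%N -> g i.+1 = 0 by move=> Ni; rewrite g0 // leqW.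
rewrite !(bsumE _ g0') (bsumE _ gS) !big_ord_recl !gbinom0 -addrA.
congr (_ + _); rewrite -big_split /=; apply: eq_bigr => i _.
by rewrite /bump /= add1n gbinomS // scalerDl.
Qed.

(** ** The recursion *)

(** X l m n stands for the residue of a function of x0, x1, x2 against
    x0^l x1^m x2^n; the equation is multiplication by x0 = x1 - x2. *)
Definition jacobi_rec (X : int -> int -> int -> U) : Prop :=
  forall l m n, X (l + 1) m n = X l (m + 1) n - X l m (n + 1).

Implicit Types (X Z : int -> int -> int -> U) (A : int -> int -> U).

Lemma jacobi_recB X Z : jacobi_rec X -> jacobi_rec Z ->
  jacobi_rec (fun l m n => X l m n - Z l m n).
Proof.
move=> hX hZ l m n; rewrite hX hZ !opprD !opprK !addrA.
by rewrite -!addrA; congr (_ + _); rewrite addrCA; congr (_ + _); rewrite addrC.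
Qed.

(** The values at l = 0 propagate to l > 0 by the recursion.  To go from l + 1
    to l, the recursion only gives X(l,m,n) = X(l,m-1,n+1), and iterating this
    raises n until X vanishes. *)
Lemma jacobi_rec_eq0_l X N : jacobi_rec X -> (forall m n, X 0 m n = 0) ->
  (forall l m n, N <= n -> X l m n = 0) -> forall l m n, X l m n = 0.
Proof.
move=> hX X0 Xbig.
apply: int_ind_both => // [l h m n|l h m n]; first by rewrite hX !h subrr.
move: n m; apply: (@int_ind_down _ N) => [n Nn m|n ih m]; first exact: Xbig.
by have := hX l (m - 1) n; rewrite h subrK ih subr0.
Qed.

(** Same argument with m in place of l: descending in m, the recursion gives
    X(l,m,n) = - X(l+1,m,n-1), which raises l until X vanishes. *)
Lemma jacobi_rec_eq0_m X L : jacobi_rec X -> (forall l n, X l 0 n = 0) ->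
  (forall l m n, L <= l -> X l m n = 0) -> forall l m n, X l m n = 0.
Proof.
move=> hX X0 Xbig l m n; move: m l n.
apply: int_ind_both => // [m h l n|m h l n].
  by have /eqP := hX l m n; rewrite !h subr0 eq_sym => /eqP.
move: l n; apply: (@int_ind_down _ L) => [l Ll n|l ih n]; first exact: Xbig.
have /eqP := hX l m (n - 1); rewrite ih h sub0r subrK eq_sym oppr_eq0.
by move=> /eqP.
Qed.

(** Descending in l and, for fixed l, in m: the recursion expresses X(l,m,n)
    by values at (l,m+1) and (l+1,m). *)
Lemma jacobi_rec_eq0_corner X L M : jacobi_rec X ->
  (forall l m n, L <= l -> X l m n = 0) ->
  (forall l m n, M <= m -> X l m n = 0) -> forall l m n, X l m n = 0.
Proof.
move=> hX XL XM.
apply: (@int_ind_down _ L) => [l Ll m n|l h m n]; first exact: XL.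
move: m n; apply: (@int_ind_down _ M) => [m Mm n|m ih n]; first exact: XM.
have /eqP := hX l m (n - 1); rewrite h ih sub0r subrK eq_sym oppr_eq0.
by move=> /eqP.
Qed.

(** For the iterate Y(Y(a,x0)b,x2)w, with A l n = (a_l b)_n w: the power x1^m
    is (x2 + x0)^m, expanded in nonnegative powers of x0. *)
Definition iterate_sum A l m n : U :=
  bsum m (fun i => A (l + i%:Z) (m + n - i%:Z)).

(** For the product Y(a,x1)Y(b,x2)w, with A m n = a_m (b_n w): the power x0^l
    is (x1 - x2)^l, expanded in nonnegative powers of x2. *)
Definition product_sum A l m n : U :=
  bsum l (fun i => (-1) ^+ i *: A (m + l - i%:Z) (n + i%:Z)).

(** For the opposite product Y(b,x2)Y(a,x1)w, with A m n = b_n (a_m w): the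
    power x0^l is (- x2 + x1)^l, expanded in nonnegative powers of x1. *)
Definition opposite_sum A l m n : U :=
  (-1) ^ l *: bsum l (fun i => (-1) ^+ i *: A (m + i%:Z) (n + l - i%:Z)).

Lemma iterate_sum_rec A N : (forall l n, N <= l -> A l n = 0) ->
  jacobi_rec (iterate_sum A).
Proof.
move=> A0 l m n; apply/eqP; rewrite eq_sym subr_eq /iterate_sum.
rewrite (@bsumS (absz (N - l))) => [|i Ni]; last by rewrite A0 //; lia.
rewrite addrC; apply/eqP; congr (_ + _); apply: eq_finsum => i;
  by congr (_ *: A _ _); lia.
Qed.

Lemma sgnS i : (-1) ^+ i.+1 = - (-1) ^+ i :> F.
Proof. by rewrite exprS mulN1r. Qed.

Lemma bsum_opp x (g h : nat -> U) N : (forall i, (N <= i)%N -> h i = 0) ->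
  (forall i, g i = - h i) -> bsum x g = - bsum x h.
Proof.
move=> h0 gh; have g0 i : (N <= i)%N -> g i = 0.
  by rewrite gh => /h0 ->; rewrite oppr0.
rewrite (bsumE _ h0) (bsumE _ g0) -sumrN; apply: eq_bigr => i _.
by rewrite gh scalerN.
Qed.

Lemma product_sum_rec A N : (forall m n, N <= n -> A m n = 0) ->
  jacobi_rec (product_sum A).
Proof.
move=> A0 l m n; rewrite /product_sum.
rewrite (@bsumS (absz (N - n))) => [|i Ni]; last by rewrite A0 ?scaler0 //; lia.
congr (_ + _); first by apply: eq_finsum => i; congr (_ *: (_ *: A _ _)); lia.
apply: (@bsum_opp _ _ _ (absz (N - n))) => i.
  by move=> Ni; rewrite A0 ?scaler0 //; lia.
by rewrite sgnS scaleNr; congr (- (_ *: A _ _)); lia.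
Qed.

Lemma expN1S l : (-1) ^ (l + 1) = - (-1) ^ l :> F.
Proof. by rewrite expfzDr ?oppr_eq0 ?oner_eq0 // expr1z mulrN1. Qed.

Lemma opposite_sum_rec A N : (forall m n, N <= m -> A m n = 0) ->
  jacobi_rec (opposite_sum A).
Proof.
move=> A0 l m n; rewrite /opposite_sum expN1S.
rewrite (@bsumS (absz (N - m))) => [|i Ni]; last by rewrite A0 ?scaler0 //; lia.
rewrite [X in _ *: (X + _)](_ : _ =
    bsum l (fun i => (-1) ^+ i *: A (m + i%:Z) (n + 1 + l - i%:Z))); last first.
  by apply: eq_finsum => i; congr (_ *: (_ *: A _ _)); lia.
rewrite [X in _ *: (_ + X)](@bsum_opp _ _
    (fun i => (-1) ^+ i *: A (m + 1 + i%:Z) (n + l - i%:Z)) (absz (N - m))).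
- by rewrite scaleNr scalerDr scalerN opprD opprK addrC.
- by move=> i Ni; rewrite A0 ?scaler0 //; lia.
- by move=> i; rewrite sgnS scaleNr; congr (- (_ *: A _ _)); lia.
Qed.

End JacobiSums.

(** * The exponential of an endomorphism *)

Section Exponential.
Variables (F : fieldType) (U : lmodType F) (D : {linear U -> U}).
Hypothesis charF : [pchar F] =i pred0.

(** Divided powers, so that exp(xD) is the generating series of [divpow]. *)
Definition divpow (j : nat) (a : U) : U := (j`!)%:R^-1 *: iter j D a.

Lemma divpow_is_linear j : linear (divpow j).
Proof.
move=> x a b; rewrite /divpow scalerA mulrC -scalerA -scalerDr; congr (_ *: _).
by elim: j => //= j ->; rewrite linearP.
Qed.

HB.instance Definition _ j :=
  GRing.isLinear.Build F U U *:%R (divpow j) (divpow_is_linear j).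

Lemma divpowZ j x a : divpow j (x *: a) = x *: divpow j a.
Proof. exact: linearZ. Qed.

Lemma divpow0 a : divpow 0 a = a.
Proof. by rewrite /divpow fact0 invr1 scale1r. Qed.

Lemma D_divpow j a : D (divpow j a) = j.+1%:R *: divpow j.+1 a.
Proof.
rewrite /divpow linearZ /= scalerA; congr (_ *: _).
rewrite factS natrM; have := fact_neq0 charF j; have := natr_neq0 charF j.
by move=> h1 h2; field; rewrite nat1r h1 h2.
Qed.

(** For f(x) = sum_n f_n x^(-n-1), the coefficient of x^(-n-1) in
    exp(xD) f(-x): the operation that occurs in skew symmetry. *)
Definition flip_exp (f : int -> U) (n : int) : U :=
  finsum (fun j => (-1) ^ (n + j%:Z + 1) *: divpow j (f (n + j%:Z))).

Lemma flip_expE K N f n : (forall i, N <= i -> f i = 0) -> N <= n + K%:Z ->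
  flip_exp f n =
  \sum_(j < K) (-1) ^ (n + j%:Z + 1) *: divpow j (f (n + j%:Z)).
Proof.
move=> f0 NK; apply: finsumE => i Ki.
by rewrite f0 ?linear0 ?scaler0 //; lia.
Qed.

Lemma flip_exp_eq0 N f n : (forall i, N <= i -> f i = 0) -> N <= n ->
  flip_exp f n = 0.
Proof.
by move=> f0 Nn; rewrite (@flip_expE 0 N) ?big_ord0 // addr0.
Qed.

(** Exchanging b and w exchanges x0 and x1 and replaces x2 by - x2; in the
    recursion this swaps l and m and changes the sign of the shift in n, which
    the sign (-1)^(n+1) in [flip_exp] compensates. *)
Lemma flip_exp_rec (G : int -> int -> int -> U) :
  (forall l m, exists N : int, forall n, N <= n -> G l m n = 0) ->
  jacobi_rec G -> jacobi_rec (fun l m n => flip_exp (G m l) n).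
Proof.
move=> G0 hG l m n.
have [N1 h1] := G0 m (l + 1); have [N2 h2] := G0 (m + 1) l.
have [N3 h3] := G0 m l.
pose K := (absz (N1 - n) + absz (N2 - n) + absz (N3 - n))%N.
rewrite (flip_expE (K := K) h1); last by rewrite /K; lia.
rewrite (flip_expE (K := K) h2); last by rewrite /K; lia.
rewrite (flip_expE (K := K) h3); last by rewrite /K; lia.
rewrite -sumrB; apply: eq_bigr => j _.
have /eqP := hG m l (n + j%:Z); rewrite eq_sym subr_eq => /eqP ->.
rewrite linearD scalerDr (_ : n + 1 + j%:Z = n + j%:Z + 1); last by lia.
by congr (_ + _); rewrite -scaleNr [in RHS]expN1S opprK.
Qed.

End Exponential.

(** * Jacobi identity from weak commutativity and the D-bracket *)

Section VertexAlgebra.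
Variables (F : fieldType) (U : lmodType F).
Hypothesis charF : [pchar F] =i pred0.
Variables (p : int -> U -> {linear U -> U}) (one : U) (D : {linear U -> U}).
Hypothesis p0l : forall n b, p n 0 b = 0.
Hypothesis trunc : forall a b, exists N : int, forall n, N <= n -> p n a b = 0.
Hypothesis vacuum : forall n b, p n one b = if n == -1 then b else 0.
Hypothesis creation_reg : forall n a, 0 <= n -> p n a one = 0.
Hypothesis creation_lim : forall a, p (-1) a one = a.
Hypothesis D_one : D one = 0.
Hypothesis D_bracket : forall n a b,
  D (p n a b) - p n a (D b) = - (n%:~R *: p (n - 1) a b).
Hypothesis weak_comm : forall a b w, exists k : nat, forall m n,
  product_sum (fun m n => p m a (p n b w)) k%:Z m n =
  opposite_sum (fun m n => p n b (p m a w)) k%:Z m n.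

Local Notation Dp := (divpow D).
Local Notation T := (flip_exp D).

Lemma trunc_finite w (g : nat -> U) K : exists N : int, forall i n,
  (i < K)%N -> N <= n -> p n w (g i) = 0.
Proof.
elim: K => [|K [N hN]]; first by exists 0.
have [M hM] := trunc w (g K); exists (Num.max N M) => i n.
rewrite ltnS ge_max leq_eqVlt => /orP[/eqP ->|iK] /andP[Nn Mn]; first exact: hM.
exact: hN.
Qed.

Lemma mode_D n a b : p n a (D b) = D (p n a b) + n%:~R *: p (n - 1) a b.
Proof. by rewrite -[X in _ + X]opprK -D_bracket opprB addrC subrK. Qed.

(** The D-bracket integrated: Y(a,x) exp(yD) = exp(yD) Y(a,x-y), read off
    coefficientwise. *)
Lemma mode_divpow n a j b : p n a (Dp j b) =
  \sum_(t < j.+1) gbinom F n t *: Dp (j - t) (p (n - t%:Z) a b).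
Proof.
elim: j n => [|j ih] n.
  by rewrite big_ord1 /= subr0 !divpow0 gbinom0 scale1r.
apply: (scalerI (natr_neq0 charF j)).
rewrite -linearZ /= -(D_divpow D charF) mode_D !ih linear_sum /= scaler_sumr.
rewrite scaler_sumr.
under eq_bigr do rewrite linearZ /= (D_divpow D charF) scalerA.
under [X in _ + X]eq_bigr => t _.
  rewrite scalerA -(gbinom_absorb charF).
  rewrite (_ : n - 1 - t%:Z = n - t.+1%:Z); last by lia.
  rewrite -subSS; over.
rewrite big_ord_recl [in RHS]big_ord_recl big_ord_recr.
rewrite [in X in _ = _ + X]big_ord_recr /=.
rewrite -addrA; congr (_ + _); first by rewrite !subn0 scalerA mulrC.
rewrite addrA -big_split /=; congr (_ + _); last first.
  by rewrite /bump /= add1n scalerA.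
apply: eq_bigr => t _; rewrite /bump /= !add1n.
have tj := ltn_ord t.
rewrite (_ : (j - t.+1).+1 = j.+1 - t.+1)%N; last by lia.
rewrite -scalerDl scalerA; congr (_ *: _).
rewrite [_ * (_)%:R]mulrC -mulrDl; congr (_ * _).
by rewrite -natrD; congr (_%:R); lia.
Qed.

(** Y(a,x1) exp(x2 D) f(-x2) = exp(x2 D) Y(a,x1-x2) f(-x2): after moving the
    exponential to the left, Y(a,x1-x2) is expanded as in a product sum with
    l and m exchanged. *)
Lemma mode_flip_exp N m a f n : (forall i, N <= i -> f i = 0) ->
  p m a (T f n) = T (product_sum (fun m n => p m a (f n)) m 0) n.
Proof.
move=> f0; pose K := absz (N - n).
rewrite (@flip_expE _ _ _ K N) //; last by lia.
rewrite (@flip_expE _ _ _ K N); last by lia.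
  rewrite linear_sum /=.
  under eq_bigr do rewrite linearZ /= mode_divpow scaler_sumr.
  under [in RHS]eq_bigr => j _.
    rewrite /product_sum (@bsumE _ _ K); last first.
      by move=> i Ki; rewrite f0 ?linear0 ?scaler0 //; lia.
    rewrite linear_sum scaler_sumr; over.
  rewrite [RHS]exchange_big /=.
  pose G t j : U := (-1) ^ (n + j%:Z + 1) *: (gbinom F m t *:
    Dp (j - t) (p (m - t%:Z) a (f (n + j%:Z)))).
  (* Both sides sum over a triangle: t is the power of y taken from
     Y(a,x-y), and j - t is the one left in the exponential. *)
  transitivity (\sum_(t < K) \sum_(j < K | (t <= j)%N) G t j).
    under [RHS]eq_bigr do rewrite big_mkcond.
    rewrite [RHS]exchange_big; apply: eq_bigr => j _ /=.
    rewrite -big_mkcond /= (big_ord_widen_cond K xpredT (G^~ j)) //=.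
  apply: eq_bigr => t _.
  rewrite -(big_mkord (fun j => (t <= j)%N) (G t)).
  rewrite -(big_mkord xpredT (fun j => (-1) ^ (n + j%:Z + 1) *: Dp j
    (gbinom F m t *: ((-1) ^+ t *: p (0 + m - t%:Z) a (f (n + j%:Z + t%:Z)))))).
  rewrite (@big_cat_nat _ _ _ t) ?(ltnW (ltn_ord t)) //=.
  rewrite [X in X + _]big_nat_cond [X in X + _]big1 ?add0r => [|j]; last by lia.
  rewrite (@big_cat_nat _ _ _ (K - t) 0 K) ?leq_subr //=.
  rewrite [X in _ = _ + X]big_nat_cond [X in _ = _ + X]big1 ?addr0; last first.
    move=> j; rewrite andbT => /andP[Kj _].
    by rewrite f0 ?linear0 ?scaler0 ?linear0 ?scaler0 //; lia.
  rewrite -{1}[t : nat]add0n big_addn big_nat_cond [RHS]big_nat_cond.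
  apply: eq_big => [j|j _]; first by rewrite leq_addl.
  rewrite /G addnK PoszD !addrA [X in _ = _ *: Dp j X]scalerA divpowZ.
  rewrite [LHS]scalerA [RHS]scalerA; congr (_ *: _).
  rewrite [n + j%:Z + t%:Z + 1]addrAC (expfzDr (n + j%:Z + 1) t%:Z).
    by rewrite -exprnP; ring.
  by rewrite oppr_eq0 oner_eq0.
move=> i Ni; rewrite /product_sum (@bsumE _ _ 0%N) ?big_ord0 // => t _.
by rewrite f0 ?linear0 ?scaler0 //; lia.
Qed.

(** ** Skew symmetry and associativity *)

Definition skew_symmetric (a b : U) : Prop :=
  forall n, p n a b = T (fun i => p i b a) n.

(** Weak commutativity is given for one exponent; the recursion raises it. *)
Lemma weak_comm_ge a b w : exists L : int, forall l m n, L <= l ->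
  product_sum (fun m n => p m a (p n b w)) l m n =
  opposite_sum (fun m n => p n b (p m a w)) l m n.
Proof.
have [k hk] := weak_comm a b w; exists k%:Z => l m n kl.
have [N hN] := trunc b w; have [M hM] := trunc a w.
have -> : l = k%:Z + (absz (l - k%:Z))%:Z by lia.
elim: (absz _) m n => [|i ih] m n; first by rewrite addr0 hk.
rewrite -addn1 PoszD addrA.
rewrite (product_sum_rec charF (N := N)) => [|? ? /hN ->]; last exact: linear0.
rewrite (opposite_sum_rec charF (N := M)) => [|? ? /hM ->]; last exact: linear0.
by rewrite !ih.
Qed.

(** By skew symmetry of (b,w) and of the (a_l b,w), the product and the
    iterate of (a,b,w) are the images under [flip_exp], with l and m exchanged,
    of the product and of the opposite product of (a,w,b).  The latter two
    agree for m large by weak commutativity of a and w on b. *)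
Lemma associativity a b w : skew_symmetric b w ->
    (forall l, skew_symmetric (p l a b) w) ->
  exists M : int, forall l m n, M <= m ->
  iterate_sum (fun l n => p n (p l a b) w) l m n =
  product_sum (fun m n => p m a (p n b w)) l m n.
Proof.
move=> skew_bw skew_abw.
have [M hM] := weak_comm_ge a w b.
have [N hN] := trunc b w; have [Nw hNw] := trunc w b.
have [L hL] := trunc a b.
pose Q := product_sum (fun m n => p m a (p n w b)).
pose O := opposite_sum (fun m n => p n w (p m a b)).
(* Both sides are solutions that vanish for n large; compare at l = 0. *)
have QT l m n :
    product_sum (fun m n => p m a (p n b w)) l m n = T (Q m l) n.
  apply/eqP; rewrite -subr_eq0; apply/eqP; move: l m n.
  have Q0 l m n : Nw <= n -> Q l m n = 0.
    move=> Nn; rewrite /Q /product_sum (@bsumE _ _ 0%N) ?big_ord0 // => i _.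
    by rewrite hNw ?linear0 ?scaler0 //; lia.
  apply: (@jacobi_rec_eq0_l _ _ _ (Num.max N Nw)).
  - apply: jacobi_recB.
      by apply: (product_sum_rec charF (N := N)) => ? ? /hN ->; exact: linear0.
    apply: flip_exp_rec => [? ?|]; first by exists Nw; exact: Q0.
    by apply: (product_sum_rec charF (N := Nw)) => ? ? /hNw ->; exact: linear0.
  - move=> m n; rewrite {1}/product_sum bsum0 // expr0 scale1r.
    rewrite (_ : m + 0 - 0%:Z = m); last by lia.
    rewrite (_ : n + 0%:Z = n); last by lia.
    by rewrite skew_bw (@mode_flip_exp Nw) // subrr.
  - move=> l m n; rewrite ge_max => /andP[Nn Nwn].
    rewrite (@flip_exp_eq0 _ _ _ Nw) // ?subr0; last by move=> i; exact: Q0.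
    rewrite /product_sum (@bsumE _ _ 0%N) ?big_ord0 // => i _.
    by rewrite hN ?linear0 ?scaler0 //; lia.
(* Both sides are solutions that vanish for l large; compare at m = 0. *)
have IT l m n :
    iterate_sum (fun l n => p n (p l a b) w) l m n = T (O m l) n.
  apply/eqP; rewrite -subr_eq0; apply/eqP; move: l m n.
  have O0 l m n : L <= m -> O l m n = 0.
    move=> Lm; rewrite /O /opposite_sum (@bsumE _ _ 0%N) ?big_ord0 ?scaler0 //.
    by move=> i _; rewrite hL ?linear0 ?scaler0 //; lia.
  (* Only the finitely many vectors a_(m+i) b with m + i < L contribute, so
     one bound on n serves them all; it depends on l and m. *)
  have Obig l m : exists N' : int, forall n, N' <= n -> O l m n = 0.
    have [N' hN'] := trunc_finite w (fun i => p (m + i%:Z) a b) (absz (L - m)).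
    exists (N' - l + (absz (L - m))%:Z) => n Nn.
    have O_eq0 i : p (n + l - i%:Z) w (p (m + i%:Z) a b) = 0.
      have [iL|Li] := ltnP i (absz (L - m)); first by apply: hN' => //; lia.
      by rewrite hL ?linear0 //; lia.
    rewrite /O /opposite_sum (@bsumE _ _ 0%N) ?big_ord0 ?scaler0 // => i _.
    by rewrite O_eq0 scaler0.
  apply: (@jacobi_rec_eq0_m _ _ _ L).
  - apply: jacobi_recB.
      by apply: (iterate_sum_rec charF (N := L)) => l n Ll; rewrite hL // p0l.
    apply: flip_exp_rec => //.
    by apply: (opposite_sum_rec charF (N := L)) => ? ? /hL ->; exact: linear0.
  - move=> l n; rewrite {1}/iterate_sum bsum0 //.
    rewrite (_ : 0 + n - 0%:Z = n); last by lia.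
    rewrite (_ : l + 0%:Z = l) ?skew_abw; last by lia.
    apply/eqP; rewrite subr_eq0; apply/eqP; congr (T _ n); apply/funext => i.
    rewrite /O /opposite_sum bsum0 // !scale1r.
    rewrite (_ : i + 0 - 0%:Z = i); last by lia.
    by rewrite (_ : l + 0%:Z = l) //; lia.
  - move=> l m n Ll.
    rewrite (@flip_exp_eq0 _ _ _ n) // ?subr0; last by move=> i _; exact: O0.
    rewrite /iterate_sum (@bsumE _ _ 0%N) ?big_ord0 // => i _.
    by rewrite hL ?p0l //; lia.
exists M => l m n Mm; rewrite IT QT; congr (T _ n); apply/funext => i.
exact/esym/hM.
Qed.

Definition borcherds (a b w : U) : Prop := forall l m n,
  iterate_sum (fun l n => p n (p l a b) w) l m n =
  product_sum (fun m n => p m a (p n b w)) l m n -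
  opposite_sum (fun m n => p n b (p m a w)) l m n.

(** The defect is a solution of the recursion; it vanishes for l large by weak
    commutativity and a_l b = 0, for m large by associativity and a_m w = 0. *)
Lemma borcherds_of_skew a b w : skew_symmetric b w ->
  (forall l, skew_symmetric (p l a b) w) -> borcherds a b w.
Proof.
move=> skew_bw skew_abw l m n; apply/eqP; rewrite -subr_eq0; apply/eqP.
have [M hM] := associativity skew_bw skew_abw.
have [L hL] := weak_comm_ge a b w.
have [Lab hLab] := trunc a b; have [Maw hMaw] := trunc a w.
have [N hN] := trunc b w.
move: l m n.
apply: (@jacobi_rec_eq0_corner _ _ _ (Num.max L Lab) (Num.max M Maw)).
- apply: jacobi_recB.
    by apply: (iterate_sum_rec charF (N := Lab)) => ? ? ?; rewrite hLab // p0l.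
  apply: jacobi_recB.
    by apply: (product_sum_rec charF (N := N)) => ? ? /hN ->; exact: linear0.
  by apply: (opposite_sum_rec charF (N := Maw)) => ? ? /hMaw ->; exact: linear0.
- move=> l m n; rewrite ge_max => /andP[Ll Labl]; rewrite hL // !subrr subr0.
  rewrite /iterate_sum (@bsumE _ _ 0%N) ?big_ord0 // => i _.
  by rewrite hLab ?p0l //; lia.
- move=> l m n; rewrite ge_max => /andP[Mm Mawm].
  rewrite hM // opprB addrC subrK.
  rewrite /opposite_sum (@bsumE _ _ 0%N) ?big_ord0 ?scaler0 // => i _.
  by rewrite hMaw ?linear0 ?scaler0 //; lia.
Qed.

(** Y(a,x)1 = exp(xD) a. *)
Lemma mode_one_divpow a j : p (- 1 - j%:Z) a one = Dp j a.
Proof.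
elim: j => [|j ih]; first by rewrite subr0 creation_lim divpow0.
apply: (scalerI (natr_neq0 charF j)); rewrite -D_divpow // -ih.
have := D_bracket (- 1 - j%:Z) a one; rewrite D_one linear0 subr0 => ->.
rewrite -scaleNr -mulrNz (_ : - 1 - j%:Z - 1 = - 1 - j.+1%:Z); last lia.
by congr (_ *: _); rewrite (_ : - (_ - _) = j.+1%:Z) //; lia.
Qed.

(** Y(1,-x)a = a, so this case of skew symmetry is Y(a,x)1 = exp(xD) a. *)
Lemma skew_symmetric_one a : skew_symmetric a one.
Proof.
move=> n; have [n0|n0] := leP 0 n.
  rewrite creation_reg // (@flip_exp_eq0 _ _ _ n) // => i ni.
  by rewrite vacuum ifF //; lia.
have -> : n = - 1 - (absz (n + 1))%:Z by lia.
move: (absz _) => j; rewrite mode_one_divpow.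
rewrite (@flip_expE _ _ _ j.+1 0); last 2 first.
- by move=> i i0; rewrite vacuum ifF //; lia.
- by lia.
rewrite big_ord_recr /= big1 ?add0r => [|i _].
  by rewrite subrK vacuum eqxx addrN expr0z scale1r.
by rewrite vacuum ifF ?linear0 ?scaler0 //; have := ltn_ord i; lia.
Qed.

(** The coefficient (l,-1,0) of the Borcherds identity for (a,b,1): the product
    sum vanishes because b_i 1 = 0 for i >= 0, and the opposite sum reduces to
    its first term b_l (a_(-1) 1) = b_l a. *)
Lemma skew_symmetry b a : skew_symmetric b a.
Proof.
move=> l; have := borcherds_of_skew (skew_symmetric_one b)
  (fun l => skew_symmetric_one (p l a b)) l (-1) 0.
have [N hN] := trunc a b; pose K := absz (N - l).
have hK i : (K <= i)%N -> p (l + i%:Z) a b = 0 by move=> Ki; rewrite hN //; lia.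
rewrite [product_sum _ _ _ _](@bsumE _ _ 0%N) ?big_ord0 ?sub0r => [|i _];
  last first.
  by rewrite creation_reg ?linear0 ?scaler0.
rewrite [opposite_sum _ _ _ _](_ : _ = (-1) ^ l *: p l b a); last first.
  rewrite /opposite_sum (@bsumE _ _ 1%N) => [|[|i] // _]; last first.
    by rewrite creation_reg ?linear0 ?scaler0 //; lia.
  rewrite big_ord1 gbinom0 !scale1r (_ : 0 + l - 0%:Z = l); last by lia.
  by rewrite (_ : -1 + 0%:Z = -1) ?creation_lim //; lia.
rewrite /iterate_sum (@bsumE _ _ K) => [|i Ki]; last by rewrite hK // p0l.
rewrite (@flip_expE _ _ _ K N) //; last by lia.
move=> /(congr1 (fun x => - ((-1) ^ l *: x))) /=; rewrite scalerN opprK scalerA.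
rewrite -expfzMl mulrNN mulr1 exp1rz scale1r => <-.
rewrite -scaleNr -expN1S scaler_sumr.
apply: eq_bigr => i _; rewrite gbinomN1 //.
rewrite (_ : -1 + 0 - i%:Z = -1 - i%:Z) ?mode_one_divpow ?scalerA; last by lia.
rewrite exprnP -expfzDr ?oppr_eq0 ?oner_eq0 //.
by rewrite (_ : l + i%:Z + 1 = l + 1 + i%:Z) //; lia.
Qed.

Lemma borcherds_identity a b w : borcherds a b w.
Proof.
by apply: borcherds_of_skew => [|l]; exact: skew_symmetry.
Qed.

End VertexAlgebra.

(** * Functionals that separate points *)

Definition separating (F : fieldType) (V : lmodType F)
    (S : set {linear V -> F^o}) : Prop :=
  forall v, (forall f, S f -> f v = 0) -> v = 0.

Section Separation.
Variable F : fieldType.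
Implicit Types U V W : lmodType F.

Definition pack_linear V W (f : V -> W) (f_lin : linear f) : {linear V -> W} :=
  HB.pack f (GRing.isLinear.Build F V W *:%R f f_lin).

(** A subspace A that is maximal among those that avoid v (Zorn) is a
    hyperplane complementary to the line of v; the functional is the coordinate
    along v. *)
Lemma exists_functional V (v : V) : v != 0 ->
  exists f : {linear V -> F^o}, f v != 0.
Proof.
move=> v0.
(* Closure under a *: u + w is satisfied by the empty set, as it must be for
   the empty chain; maximality then provides 0. *)
pose P (A : set V) := (forall a u w, A u -> A w -> A (a *: u + w)) /\ ~ A v.
have [|A [[Alin Av] Amax]] := @Zorn_bigcup V P.
  move=> C CP Ctot; split=> [a u w [X CX Xu] [Z CZ Zw]|[X CX Xv]].
    have [XZ|ZX] := Ctot _ _ CX CZ.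
      by exists Z => //; apply: (CP _ CZ).1 => //; exact: XZ.
    by exists X => //; apply: (CP _ CX).1 => //; exact: ZX.
  exact: (CP _ CX).2.
have A0 : A 0.
  have [[u Au]|Aempty] := pselect (exists u, A u).
    by rewrite -(addNr u) -scaleN1r; exact: Alin.
  exfalso; apply: (Amax [set 0]); last first.
    by split=> [a u w /= -> ->|/eqP]; rewrite ?scaler0 ?addr0 // (negPf v0).
  split=> [u Au|/(_ 0 erefl) A0]; first by case: Aempty; exists u.
  by apply: Aempty; exists 0.
have Adecomp w : exists a, A (w - a *: v).
  have [Aw|Aw] := pselect (A w); first by exists 0; rewrite scale0r subr0.
  pose B := [set x | exists a m, A m /\ x = a *: w + m].
  have Blin a u u' : B u -> B u' -> B (a *: u + u').
    move=> [x [m [Am ->]]] [x' [m' [Am' ->]]].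
    exists (a * x + x'), (a *: m + m'); split; first exact: Alin.
    by rewrite scalerDr scalerDl scalerA addrACA.
  have [a [m [Am vE]]] : B v.
    apply: contrapT => Bv; apply: (Amax B) => //; split=> [u Au|BA].
      by exists 0, u; rewrite scale0r add0r.
    by apply/Aw/BA; exists 1, 0; rewrite scale1r addr0.
  have a0 : a != 0.
    by apply: contra_not_neq Av => a0; rewrite vE a0 scale0r add0r.
  exists a^-1; rewrite vE scalerDr scalerA mulVf // scale1r.
  rewrite opprD addrA subrr add0r.
  by rewrite -scaleNr -[_ *: m]addr0; exact: Alin.
have Auniq w a b : A (w - a *: v) -> A (w - b *: v) -> a = b.
  move=> Aa Ab; apply/eqP; rewrite -subr_eq0; apply/negPn/negP => ab.
  apply: Av; have : A ((a - b) *: v).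
    have := Alin (-1) _ _ Aa Ab; rewrite scaleN1r opprB addrA subrK.
    by rewrite scalerBl.
  move=> Aab; have := Alin (a - b)^-1 _ _ Aab A0.
  by rewrite scalerA mulVf // scale1r addr0.
pose f w : F^o := sval (cid (Adecomp w)).
have fP w : A (w - f w *: v) by exact: svalP (cid (Adecomp w)).
have f_lin : linear f.
  move=> a u w; apply: (Auniq (a *: u + w)); first exact: fP.
  have := Alin a _ _ (fP u) (fP w).
  by rewrite scalerBr scalerA addrACA -opprD -scalerDl.
exists (pack_linear f_lin) => /=.
rewrite (_ : f v = 1) ?oner_neq0 //; apply: (Auniq v) => //.
by rewrite scale1r subrr.
Qed.

Lemma tform_is_bilinear U W (f : {linear U -> F^o}) (g : {linear W -> F^o}) :
  is_bilinear (fun u w => f u * g w : F^o).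
Proof.
by split=> [w a u u'|u a w w']; rewrite linearP ?mulrDl ?mulrDr ?mulrA //
  -?mulrA // [f u * _]mulrCA.
Qed.

(** The functional f (x) g. *)
Definition tform U W (f : {linear U -> F^o}) (g : {linear W -> F^o}) :
  {linear tensor U W -> F^o} := tlift (tform_is_bilinear f g).

Lemma tformE U W (f : {linear U -> F^o}) (g : {linear W -> F^o}) u w :
  tform f g (tens u w) = f u * g w.
Proof. exact: tlift_tens. Qed.

Lemma tform_reprE U W (f : {linear U -> F^o}) (g : {linear W -> F^o}) t :
  tform f g t = \sum_(q <- repr t) f q.1 * g q.2.
Proof. by []. Qed.

(** Contracting the second factor with g in R gives a vector of U killed by S,
    hence 0: sum_q g(q.2) q.1 = 0 for all g in R.  If w is nonzero in some term
    u (x) w, a g with g(w) nonzero makes this relation express u by the other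
    first factors, which gives a shorter sum for t with the same property. *)
Lemma separating_tensor U W (S : set {linear U -> F^o})
    (R : set {linear W -> F^o}) : separating S -> separating R ->
  separating [set h | exists f g, [/\ S f, R g & h = tform f g]].
Proof.
move=> sepS sepR t t0.
have {t0}: forall g, R g -> \sum_(q <- repr t) g q.2 *: q.1 = 0.
  move=> g Rg; apply: sepS => f Sf.
  rewrite -[RHS](t0 (tform f g)); last by exists f, g.
  rewrite linear_sum tform_reprE; apply: eq_bigr => q _.
  by rewrite linearZ mulrC.
move=> contr0; rewrite [t]tensor_reprE; move: (repr t) contr0 => s {t}.
have [n] := ubnP (size s); elim: n s => // n ih [|[u w] s] /=.
  by move=> _ _; rewrite big_nil.
rewrite ltnS => sn; have [->|w0] := eqVneq w 0 => s0.
  rewrite big_cons /= -(scale0r w) tensZr scale0r add0r ih // => g Rg.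
  by have := s0 g Rg; rewrite big_cons /= linear0 scale0r add0r.
have [g Rg gw] : exists2 g, R g & g w != 0.
  apply: contrapT => noR; case/eqP: w0; apply: sepR => g Rg.
  by apply/eqP/negPn/negP => gw; apply: noR; exists g.
pose co (q : U * W) : F := g q.2 / g w.
have uE : u = - \sum_(q <- s) co q *: q.1.
  have /eqP := s0 g Rg; rewrite big_cons addr_eq0 /= => /eqP.
  move=> /(congr1 ( *:%R (g w)^-1)); rewrite scalerA mulVf // scale1r => ->.
  rewrite scalerN scaler_sumr; congr (- _); apply: eq_bigr => q _.
  by rewrite scalerA mulrC.
pose s' := [seq (q.1, q.2 - co q *: w) | q <- s].
have tE : \sum_(q <- (u, w) :: s) tens q.1 q.2 = \sum_(q <- s') tens q.1 q.2.
  rewrite big_cons big_map /= uE -[- \sum_(_ <- _) _]scaleN1r tensZl.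
  have -> : tens (\sum_(q <- s) co q *: q.1) w =
      \sum_(q <- s) tens (co q *: q.1) w.
    have t0w : tens 0 w = 0 :> tensor U W.
      by rewrite -(scale0r 0) tensZl scale0r.
    by apply: (big_morph (fun x => tens x w)) => // x y; rewrite tensDl.
  rewrite scaler_sumr -big_split /=; apply: eq_bigr => q _.
  by rewrite addrC -scaleN1r !tensDr !tensZr tensZl.
rewrite tE; apply: ih; first by rewrite size_map.
move=> h Rh; rewrite big_map /=; have := s0 h Rh; rewrite big_cons /= => s0h.
under eq_bigr do rewrite linearB linearZ /= scalerBl.
rewrite sumrB -[LHS](addKr (h w *: u)) [h w *: u + _]addrA s0h add0r -opprD.
apply/eqP; rewrite oppr_eq0 uE scalerN addrC subr_eq0 scaler_sumr; apply/eqP.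
by apply: eq_bigr => q _; rewrite scalerA mulrC.
Qed.

End Separation.

(** * Homogeneous components and the graded dual *)

Section Homogeneous.
Variables (F : fieldType) (V : lmodType F) (gr : int -> set V).
Hypothesis grV : is_grading gr.

Definition hcomp (k : int) (w : V) : V :=
  sval (cid (grading_decomp grV w)) k.

Lemma hcompP w : [/\ forall k, gr k (hcomp k w),
  finite_set [set k | hcomp k w != 0] & w = \sum_(k \in [set: int]) hcomp k w].
Proof. exact: (svalP (cid (grading_decomp grV w))).1. Qed.

Lemma hcomp_uniq w f : [/\ forall k, gr k (f k),
  finite_set [set k | f k != 0] & w = \sum_(k \in [set: int]) f k] ->
  forall k, hcomp k w = f k.
Proof.
move=> /((svalP (cid (grading_decomp grV w))).2 f) fE k.
by rewrite /hcomp fE.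
Qed.

Lemma fsum_support (W : lmodType F) (f : int -> W) (A : set int) :
  finite_set A -> (forall k, f k != 0 -> A k) ->
  \sum_(k \in [set: int]) f k = \sum_(k <- fset_set A) f k.
Proof.
move=> Afin fA; rewrite -fsbig_finite //.
apply/esym/fsbig_widen => // k /= [_ nA].
by apply/eqP/negPn/negP => /fA.
Qed.

Lemma hcomp_is_linear k : linear (hcomp k).
Proof.
move=> a u w; have [gu fu uE] := hcompP u; have [gw fw wE] := hcompP w.
apply: (hcomp_uniq (f := fun k => a *: hcomp k u + hcomp k w)).
pose A := [set k | hcomp k u != 0] `|` [set k | hcomp k w != 0].
have Afin : finite_set A by rewrite finite_setU.
have supp j : a *: hcomp j u + hcomp j w != 0 -> A j.
  apply: contraNP => /not_orP[/negP]; rewrite negbK => /eqP -> /negP.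
  by rewrite negbK => /eqP ->; rewrite scaler0 addr0.
split; first by move=> j; apply: grading_linear.
  exact: sub_finite_set supp Afin.
rewrite (fsum_support Afin supp) big_split /= -scaler_sumr.
rewrite -(fsum_support (f := hcomp^~ u) Afin); last by left.
by rewrite -(fsum_support (f := hcomp^~ w) Afin) -?uE -?wE //; right.
Qed.

HB.instance Definition _ k :=
  GRing.isLinear.Build F V V *:%R (hcomp k) (hcomp_is_linear k).

Lemma hcomp_homogeneous r w k : gr r w -> hcomp k w = if k == r then w else 0.
Proof.
move=> gw; apply: (hcomp_uniq (f := fun k => if k == r then w else 0)).
have supp j : (if j == r then w else 0) != 0 -> [set r] j.
  by have [//|_] := eqVneq j r; rewrite eqxx.
split; first by move=> j; case: eqP => [->|_] //; exact: grading0.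
  exact: sub_finite_set supp (finite_set1 r).
by rewrite (fsum_support (finite_set1 r) supp) fset_set1 big_seq_fset1 eqxx.
Qed.

Lemma functional_eq0 (f : {linear V -> F^o}) :
  (forall k w, gr k w -> f w = 0) -> forall w, f w = 0.
Proof.
move=> f0 w; have [gw fw ->] := hcompP w.
rewrite (fsum_support fw) // linear_sum big1 // => k _; exact: f0 (gw k).
Qed.

(** A nonzero v has a nonzero component of some weight k; compose with the
    projection to weight k a functional that does not vanish on it. *)
Lemma graded_dual_separating : separating (graded_dual gr).
Proof.
move=> v v0; have [gv fv vE] := hcompP v; rewrite vE fsbig1 // => k _.
apply: contrapT => /eqP /exists_functional [f]; apply/negP; rewrite negbK.
pose g := pack_linear (linearP (f \o hcomp k)).
apply/eqP; apply: (v0 g); apply: sub_finite_set (finite_set1 k) => j /= [w gw].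
rewrite (hcomp_homogeneous _ gw); have [//|_] := eqVneq k j.
by rewrite linear0 eqxx.
Qed.

End Homogeneous.

Lemma graded_dual_tform (F : fieldType) (U W : lmodType F) (grU : int -> set U)
    (grW : int -> set W) (f : {linear U -> F^o}) (g : {linear W -> F^o}) :
  graded_dual grU f -> graded_dual grW g ->
  graded_dual (tensor_grading grU grW) (tform f g).
Proof.
move=> fin_f fin_g; apply: sub_finite_set (finite_image2 +%R fin_f fin_g).
move=> n /= [t [s -> s_hom]]; rewrite linear_sum => /eqP sum0.
have [q qs] : exists2 q, q \in s & tform f g (tens q.1 q.2) != 0.
  apply: contrapT => no; apply: sum0; rewrite big_seq big1 // => q qs.
  by apply/eqP/negPn/negP => q0; apply: no; exists q.
rewrite tformE mulf_eq0 => /norP[f0 g0].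
have [i [j [gi gj ij]]] := s_hom q qs.
by exists i; [exists q.1|exists j; [exists q.2|]].
Qed.

Lemma finite_set_int_bounded (A : set int) : finite_set A ->
  exists N : int, forall k, A k -> k < N.
Proof.
move=> /finite_seqP[s ->]; elim: s => [|a s [N hN]]; first by exists 0.
exists (Num.max N (a + 1)) => k; rewrite /= inE => /orP[/eqP ->|ks].
  by rewrite lt_max; lia.
by rewrite lt_max hN.
Qed.

Section GradedDual.
Variables (F : fieldType) (V : lmodType F) (gr : int -> set V).

(** Functions rather than linear maps, because functions with values in F form
    a vector space of which the graded functionals are a subspace. *)
Definition graded_form : {pred V -> F^o} := fun f =>
  `[< linear f /\ finite_set [set k | exists2 w, gr k w & f w != 0] >].

Fact graded_form_submod : submod_closed graded_form.
Proof.
split=> [|a f g /asboolP[f_lin f_fin] /asboolP[g_lin g_fin]]; apply/asboolP.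
  split; first by move=> a u w; rewrite scaler0 addr0.
  by apply: sub_finite_set (finite_set0 _) => k /= [w _]; rewrite eqxx.
split.
  move=> x u w; rewrite !fctE f_lin g_lin !scalerDr addrACA; congr (_ + _ + _).
  by rewrite !scalerA mulrC.
pose A := [set k | exists2 w, gr k w & f w != 0] `|`
          [set k | exists2 w, gr k w & g w != 0].
apply: (@sub_finite_set _ _ A); last by rewrite finite_setU.
move=> k /= [w gw fg0]; have [f0|fw] := eqVneq (f w) 0; last by left; exists w.
right; exists w => //; apply: contraNneq fg0 => g0.
by rewrite !fctE f0 g0 scaler0 addr0.
Qed.

HB.instance Definition _ :=
  GRing.isSubmodClosed.Build F (V -> F^o) graded_form graded_form_submod.

Record gdual := GDual {
  gdual_fun :> V -> F^o;
  gdualP : gdual_fun \in graded_form }.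
HB.instance Definition _ := [isSub for gdual_fun].
HB.instance Definition _ := [Choice of gdual by <:].
HB.instance Definition _ := [SubChoice_isSubLmodule of gdual by <:].

Lemma gdual_is_linear (f : gdual) : linear f.
Proof. by have /asboolP[] := gdualP f. Qed.

HB.instance Definition _ (f : gdual) :=
  GRing.isLinear.Build F V F^o *:%R (gdual_fun f) (gdual_is_linear f).

Lemma gdual_graded (f : gdual) : graded_dual gr f.
Proof. by have /asboolP[] := gdualP f. Qed.

Lemma gdual_ext (f g : gdual) : (forall v, f v = g v) -> f = g.
Proof. by move=> fg; apply/val_inj/funext. Qed.

Lemma pack_gdual_subproof (f : {linear V -> F^o}) : graded_dual gr f ->
  (f : V -> F^o) \in graded_form.
Proof. by move=> ?; apply/asboolP; split=> //; exact: linearP. Qed.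

Definition pack_gdual (f : {linear V -> F^o}) (fgr : graded_dual gr f) :
  gdual := GDual (pack_gdual_subproof fgr).

Definition gdual_eval (v : V) (f : gdual) : F^o := f v.

Lemma gdual_eval_is_linear v : linear (gdual_eval v).
Proof. by []. Qed.

HB.instance Definition _ v :=
  GRing.isLinear.Build F gdual F^o *:%R (gdual_eval v)
    (gdual_eval_is_linear v).

End GradedDual.

Section TformLinear.
Variables (F : fieldType) (U W : lmodType F).
Implicit Types (f : {linear U -> F^o}) (g : {linear W -> F^o}).

Lemma tform_linear_r f g g1 g2 a t : (forall w, g w = a * g1 w + g2 w) ->
  tform f g t = a * tform f g1 t + tform f g2 t.
Proof.
move=> gE; rewrite !tform_reprE mulr_sumr -big_split /=.
by apply: eq_bigr => q _; rewrite gE mulrDr mulrCA.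
Qed.

Lemma tform_linear_l f f1 f2 g a t : (forall u, f u = a * f1 u + f2 u) ->
  tform f g t = a * tform f1 g t + tform f2 g t.
Proof.
move=> fE; rewrite !tform_reprE mulr_sumr -big_split /=.
by apply: eq_bigr => q _; rewrite fE mulrDl mulrA.
Qed.

End TformLinear.

(** * The vertex algebra structure of the graded dual *)

Section DualVertexAlgebra.
Variables (F : fieldType) (V : lmodType F) (gr : int -> set V).
Hypothesis charF : [pchar F] =i pred0.
Variables (Y : {linear V -> (int -> tensor V V)}) (c : {linear V -> F^o}).
Hypothesis VC : graded_vertex_coalgebra_but_jacobi Y c gr.
Hypothesis WC : weak_cocommutativity Y gr.
Hypothesis DB : Dstar_bracket Y c.

Let grV : is_grading gr := gvc_grading VC.
Local Notation U := (gdual gr).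

Lemma mode_form_is_linear (a b : {linear V -> F^o}) n :
  linear (fun v => tform a b (Delta Y n v) : F^o).
Proof. by move=> x u v; rewrite /Delta !linearP. Qed.

Definition mode_form (a b : {linear V -> F^o}) n : {linear V -> F^o} :=
  pack_linear (mode_form_is_linear a b n).

Lemma mode_form_supp (a b : U) n k v : gr k v -> mode_form a b n v != 0 ->
  exists2 t, tensor_grading gr gr (k + n + 1) t & tform a b t != 0.
Proof. by move=> gv; exists (Delta Y n v) => //; exact: (gvc_weight VC). Qed.

Lemma tform_supp (a b : U) : graded_dual (tensor_grading gr gr) (tform a b).
Proof. by apply: graded_dual_tform; exact: gdual_graded. Qed.

Lemma mode_form_graded (a b : U) n : graded_dual gr (mode_form a b n).
Proof.
apply: sub_finite_set (finite_image (fun k => k - n - 1) (tform_supp a b)).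
move=> k /= [v gv /(mode_form_supp gv)] [t gt t0].
by exists (k + n + 1); [exists t|lia].
Qed.

Definition mode n (a b : U) : U := pack_gdual (mode_form_graded a b n).

Lemma modeE n a b v : mode n a b v = tform a b (Delta Y n v).
Proof. by []. Qed.

Lemma mode_is_linear n a : linear (mode n a).
Proof.
move=> x b b'; apply: gdual_ext => v; rewrite [RHS]/= modeE.
exact: tform_linear_r.
Qed.

HB.instance Definition _ n a :=
  GRing.isLinear.Build F U U *:%R (mode n a) (mode_is_linear n a).

Lemma mode_is_linear_l n b : linear (mode n ^~ b).
Proof.
move=> x a a'; apply: gdual_ext => v; rewrite [RHS]/= modeE.
exact: tform_linear_l.
Qed.

Lemma mode0l n b : mode n 0 b = 0.
Proof.
have := mode_is_linear_l n b (-1) 0 0.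
by rewrite scaler0 addr0 scaleN1r addNr.
Qed.

(** a (x) b vanishes in large weights, and Delta_n raises weights by n + 1 from
    a bounded below spectrum. *)
Lemma mode_trunc a b : exists N : int, forall n, N <= n -> mode n a b = 0.
Proof.
have [K hK] := finite_set_int_bounded (tform_supp a b).
have [B hB] := gvc_bounded_below VC.
exists (K - B) => n Nn; apply: gdual_ext => v.
apply: (functional_eq0 grV) => k w gw.
have [kB|Bk] := ltP k B; first by rewrite (hB k kB w gw) linear0.
apply/eqP/negPn/negP => /(mode_form_supp gw) tE.
by have := hK _ tE; lia.
Qed.

Lemma tform_counitr (f : {linear V -> F^o}) t : tform f c t = f (counitr c t).
Proof.
rewrite /counitr.
apply: (tlift_unique (g := f \o trunit V \o tmap idfun c)) => u w.
change (tform f c (tens u w) = f (trunit V (tmap idfun c (tens u w)))).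
by rewrite tmapE [trunit V _]tlift_tens tformE linearZ mulrC.
Qed.

Lemma tform_counitl (f : {linear V -> F^o}) t : tform c f t = f (counitl c t).
Proof.
rewrite /counitl.
apply: (tlift_unique (g := f \o tlunit V \o tmap c idfun)) => u w.
change (tform c f (tens u w) = f (tlunit V (tmap c idfun (tens u w)))).
by rewrite tmapE [tlunit V _]tlift_tens tformE linearZ.
Qed.

(** The counit is not assumed homogeneous.  For v of weight r, let c_k be c
    composed with the projection to weight k.  On the weight r part of
    V (x) V the functionals c_0 (x) c and c (x) c_r agree.  On the coefficient
    of x^0 in Y(x)v the first is c_0(v) by cocreation and the second is
    c_r(v) = c(v) by the counit axiom; so c(v) = c_0(v), which is 0 unless
    r = 0. *)
Lemma counit_weight0 r v : gr r v -> r != 0 -> c v = 0.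
Proof.
move=> gv r0; have [s tE s_hom] := gvc_weight VC (-1) gv.
rewrite addrNK /Delta opprK subrr in tE s_hom.
pose c0 := pack_linear (linearP (c \o hcomp grV 0)).
pose cr := pack_linear (linearP (c \o hcomp grV r)).
have <- : cr (counitl c (Y v 0)) = c v.
  by rewrite (gvc_counit VC) eqxx /cr /= (hcomp_homogeneous _ _ gv) eqxx.
have <- : c0 (counitr c (Y v 0)) = 0.
  rewrite (gvc_cocreation_lim VC) /c0 /= (hcomp_homogeneous _ _ gv).
  by rewrite eq_sym (negPf r0) linear0.
rewrite -tform_counitr -tform_counitl [Y v 0]tE !linear_sum.
apply: eq_big_seq => q qs; have [i [j [gi gj ij]]] := s_hom q qs.
rewrite !tformE /c0 /cr /= (hcomp_homogeneous _ _ gi).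
rewrite (hcomp_homogeneous _ _ gj).
have -> : (r == j) = (0 == i) by lia.
by case: eqP => // _; rewrite !linear0 mulr0 mul0r.
Qed.

Lemma counit_graded : graded_dual gr c.
Proof.
apply: sub_finite_set (finite_set1 0) => k /= [v gv].
by apply: contra_neqP => /eqP k0; exact: counit_weight0 gv k0.
Qed.

Definition vac : U := pack_gdual counit_graded.

Lemma mode_vacuum n b : mode n vac b = if n == -1 then b else 0.
Proof.
apply: gdual_ext => v; rewrite modeE [LHS]tform_counitl (gvc_counit VC).
rewrite (_ : (_ == 0) = (n == -1)); last by lia.
by case: ifP => // _; rewrite linear0.
Qed.

Lemma mode_creation_reg n a : 0 <= n -> mode n a vac = 0.
Proof.
move=> n0; apply: gdual_ext => v; rewrite modeE [LHS]tform_counitr.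
by rewrite (gvc_cocreation_reg VC) ?linear0 //; lia.
Qed.

Lemma mode_creation_lim a : mode (-1) a vac = a.
Proof.
apply: gdual_ext => v; rewrite modeE [LHS]tform_counitr /Delta opprK subrr.
by rewrite [Ycoef _ _ _](_ : _ = Y v 0) // (gvc_cocreation_lim VC).
Qed.

Definition deriv_dual : {linear U -> U} :=
  pack_linear (mode_is_linear_l (-2) vac).

Lemma deriv_dualE a v : deriv_dual a v = a (Dstar Y c v).
Proof. by rewrite [LHS]tform_counitr. Qed.

Lemma deriv_dual_vac : deriv_dual vac = 0.
Proof. by rewrite [LHS]mode_vacuum. Qed.

Lemma deriv_dual_bracket n a b :
  deriv_dual (mode n a b) - mode n a (deriv_dual b) =
  - (n%:~R *: mode (n - 1) a b).
Proof.
apply: gdual_ext => v.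
transitivity (deriv_dual (mode n a b) v - mode n a (deriv_dual b) v) => //.
rewrite deriv_dualE !modeE.
have -> : tform a (deriv_dual b) (Delta Y n v) =
    tform a b (tmap idfun (Dstar Y c) (Delta Y n v)).
  apply: (tlift_unique (g := tform a b \o tmap idfun (Dstar Y c))) => u w.
  change (tform a (deriv_dual b) (tens u w) =
    tform a b (tmap idfun (Dstar Y c) (tens u w))).
  by rewrite tmapE !tformE; congr (_ * _); exact: deriv_dualE.
rewrite -linearB /=.
have -> : Delta Y n (Dstar Y c v) - tmap idfun (Dstar Y c) (Delta Y n v) =
    - (n%:~R *: Delta Y (n - 1) v).
  have := congr1 (fun s => s (- n - 1)) (DB v); rewrite /fderiv subrK => DBn.
  rewrite [LHS](esym DBn) intrN scaleNr; congr (- (_ *: _)).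
  by rewrite /Delta /Ycoef; congr (Y v _); lia.
by rewrite linearN linearZ.
Qed.

End DualVertexAlgebra.

(** * Pairing with the Jacobi identity *)

Lemma linear_finsum (F : fieldType) (U W : lmodType F) (f : {linear U -> W})
    (K : nat) (g : nat -> U) : (forall i, (K <= i)%N -> g i = 0) ->
  f (finsum g) = finsum (fun i => f (g i)).
Proof.
move=> g0; rewrite (finsumE g0) (@finsumE _ _ K) ?linear_sum // => i /g0 ->.
exact: linear0.
Qed.

(** The delta series in the Jacobi identity are supported on a line once the
    exponent of the variable absent from the other factor is fixed. *)
Lemma cauchy_mul_image (F : fieldType) (W : lmodType F) (E : zmodType)
    (d : E -> F) (A : E -> W) (h : nat -> E) n : injective h ->
  (forall e, d e != 0 -> A (n - e) != 0 -> exists i, e = h i) ->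
  cauchy_mul d A n = finsum (fun i => d (h i) *: A (n - h i)).
Proof.
move=> h_inj supp; rewrite /finsum.
rewrite -(@fsbig_image _ _ _ _ _ setT h (fun e => d e *: A (n - e)));
  last by move=> i j _ _; exact: h_inj.
apply/esym/fsbig_widen => // e [_ nh].
apply: contrapT => /eqP /cauchy_supp[d0 A0].
by have [i ei] := supp e d0 A0; apply: nh; exists i.
Qed.

Lemma sub_powE (F : fieldType) (l a : int) (i : nat) : a = l - i%:Z ->
  sub_pow F l (a, i%:Z) = (-1) ^+ i * gbinom F l i.
Proof. by move=> ->; rewrite /sub_pow subrK eqxx. Qed.

Section Pairing.
Variables (F : fieldType) (V : lmodType F) (gr : int -> set V).
Hypothesis charF : [pchar F] =i pred0.
Variables (Y : {linear V -> (int -> tensor V V)}) (c : {linear V -> F^o}).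
Hypothesis VC : graded_vertex_coalgebra_but_jacobi Y c gr.
Hypothesis WC : weak_cocommutativity Y gr.
Hypothesis DB : Dstar_bracket Y c.
Local Notation mode := (mode VC).
Implicit Types (a b w : gdual gr) (v : V).

Definition tform3 (a b w : {linear V -> F^o}) := tform (tform a b) w.

Lemma tform3_assoc (a b w : {linear V -> F^o}) u t :
  tform3 a b w (tassoc V V V (tens u t)) = a u * tform b w t.
Proof.
have lin1 : linear (fun t => tform3 a b w (tassoc V V V (tens u t)) : F^o).
  by move=> x s s'; rewrite tensDr tensZr !linearP.
have lin2 : linear (fun t => a u * tform b w t : F^o).
  by move=> x s s'; rewrite linearP mulrDr mulrCA.
apply: (tlift_unique (f := pack_linear lin1) (g := pack_linear lin2)) => x y /=.
by rewrite tassocE /tform3 !tformE mulrA.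
Qed.

Lemma tform3_flip (a b w : {linear V -> F^o}) t :
  tform3 a b w (tmap (tflip V) idfun t) = tform3 b a w t.
Proof.
apply: (tlift_unique (f := tform3 a b w \o tmap (tflip V) idfun)) => s u.
change (tform3 a b w (tmap (tflip V) idfun (tens s u)) =
  tform3 b a w (tens s u)).
rewrite tmapE /tform3 !tformE; congr (_ * _).
apply: (tlift_unique (f := tform a b \o tflip V)) => x y.
change (tform a b (tflip V (tens x y)) = tform b a (tens x y)).
by rewrite tflipE !tformE mulrC.
Qed.

Lemma Delta_coef n v : Delta Y (- n - 1) v = Ycoef Y n v.
Proof. by rewrite /Delta (_ : - (- n - 1) - 1 = n) //; lia. Qed.

Lemma pair_Y_right a b w v n1 n2 : tform3 a b w (Y_right Y v (n1, n2)) =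
  mode (- n1 - 1) a (mode (- n2 - 1) b w) v.
Proof.
rewrite modeE Delta_coef /Y_right.
apply: (tlift_unique (f := tform3 a b w \o tassoc V V V \o
  tmap idfun (Ycoef Y n2))) => u x.
change (tform3 a b w (tassoc V V V (tmap idfun (Ycoef Y n2) (tens u x))) =
  tform a (mode (- n2 - 1) b w) (tens u x)).
rewrite tmapE tform3_assoc tformE; congr (_ * _).
by rewrite [RHS]modeE Delta_coef.
Qed.

Lemma pair_Y_right_flip a b w v n1 n2 :
  tform3 a b w (Y_right_flip Y v (n1, n2)) =
  mode (- n2 - 1) b (mode (- n1 - 1) a w) v.
Proof. by rewrite [LHS]tform3_flip [LHS]pair_Y_right. Qed.

Lemma pair_Y_left a b w v n0 n2 : tform3 a b w (Y_left Y v (n0, n2)) =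
  mode (- n2 - 1) (mode (- n0 - 1) a b) w v.
Proof.
rewrite modeE Delta_coef /Y_left.
apply: (tlift_unique (f := tform3 a b w \o tmap (Ycoef Y n0) idfun)) => u x.
change (tform3 a b w (tmap (Ycoef Y n0) idfun (tens u x)) =
  tform (mode (- n0 - 1) a b) w (tens u x)).
rewrite tmapE /tform3 !tformE; congr (_ * _).
by rewrite [RHS]modeE Delta_coef.
Qed.

Lemma eval_product_sum a b w l m n v :
  product_sum (fun m n => mode m a (mode n b w)) l m n v =
  finsum (fun i => (gbinom F l i * (-1) ^+ i) *:
    (mode (m + l - i%:Z) a (mode (n + i%:Z) b w) v : F^o)).
Proof.
have [N hN] := mode_trunc VC b w.
rewrite -[LHS]/(gdual_eval v _) /product_sum /bsum.
rewrite (@linear_finsum _ _ _ _ (absz (N - n))) => [|i Ni].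
  by apply: eq_finsum => i; rewrite scalerA linearZ.
by rewrite hN ?linear0 ?scaler0 //; lia.
Qed.

Lemma eval_opposite_sum a b w l m n v :
  opposite_sum (fun m n => mode n b (mode m a w)) l m n v =
  (-1) ^ l *: finsum (fun i => (gbinom F l i * (-1) ^+ i) *:
    (mode (n + l - i%:Z) b (mode (m + i%:Z) a w) v : F^o)).
Proof.
have [N hN] := mode_trunc VC a w.
rewrite -[LHS]/(gdual_eval v _) /opposite_sum /bsum linearZ; congr (_ *: _).
rewrite (@linear_finsum _ _ _ _ (absz (N - m))) => [|i Ni].
  by apply: eq_finsum => i; rewrite scalerA linearZ.
by rewrite hN ?linear0 ?scaler0 //; lia.
Qed.

Lemma eval_iterate_sum a b w l m n v :
  iterate_sum (fun l n => mode n (mode l a b) w) l m n v =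
  finsum (fun i => gbinom F m i *:
    (mode (m + n - i%:Z) (mode (l + i%:Z) a b) w v : F^o)).
Proof.
have [N hN] := mode_trunc VC a b.
rewrite -[LHS]/(gdual_eval v _) /iterate_sum /bsum.
rewrite (@linear_finsum _ _ _ _ (absz (N - l))) => [|i Ni].
  by apply: eq_finsum => i; rewrite linearZ.
by rewrite hN ?mode0l ?scaler0 //; lia.
Qed.

(** With f = a (x) b (x) w, weak cocommutativity says this for all v at once,
    with a k independent of v; both sides are graded functionals. *)
Lemma mode_weak_comm a b w : exists k : nat, forall m n,
  product_sum (fun m n => mode m a (mode n b w)) k%:Z m n =
  opposite_sum (fun m n => mode n b (mode m a w)) k%:Z m n.
Proof.
have [|k _ hk] := WC (v' := tform3 a b w).
  by do 2?apply: graded_dual_tform; exact: gdual_graded.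
exists k => m n; apply: gdual_ext => v.
have big0 (G : nat -> F^o) i : (k.+1 <= i)%N ->
    (gbinom F k%:Z i * (-1) ^+ i) *: G i = 0.
  by move=> ki; rewrite gbinom_nat // bin_small // mul0r scale0r.
rewrite eval_product_sum eval_opposite_sum !(@finsumE _ _ k.+1);
  do ?exact: big0.
have := congr1 (fun s => s (- m - 1, - n - 1)) (hk v).
rewrite (@cauchy_mul_image _ _ _ _ _
  (fun i : nat => (k%:Z - i%:Z, i%:Z))); last 2 first.
- by move=> i j [].
- move=> [e1 e2] /sub_pow_neq0[i -> ->] _; by exists i.
pose G i : F^o := mode (m + k%:Z - i%:Z) a (mode (n + i%:Z) b w) v.
pose H i : F^o := mode (n + i%:Z) b (mode (m + k%:Z - i%:Z) a w) v.
rewrite (@eq_finsum _ _ _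
  (fun i => (gbinom F k%:Z i * (-1) ^+ i) *: (G i - H i))); last first.
  move=> i; rewrite sub_powE // [_ ^+ _ * _]mulrC linearB.
  rewrite pair_Y_right pair_Y_right_flip /G /H.
  rewrite (_ : - (- m - 1 - (k%:Z - i%:Z)) - 1 = m + k%:Z - i%:Z); last by lia.
  by rewrite (_ : - (- n - 1 - i%:Z) - 1 = n + i%:Z) //; lia.
rewrite (finsumE (big0 _)).
under eq_bigr do rewrite scalerBr.
rewrite sumrB => /eqP; rewrite subr_eq0 => /eqP ->.
(* The expansion of (x1 - x2)^k in powers of x2 on one side, in powers of x1
   on the other: they agree since k is a natural number. *)
rewrite (reindex_inj rev_ord_inj) scaler_sumr; apply: eq_bigr => i _ /=.
have ik : (i <= k)%N by rewrite -ltnS; have := ltn_ord i.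
rewrite subSS !gbinom_nat // bin_sub //.
rewrite /H scalerA; congr (_ *: _); last first.
  by congr (mode _ _ (mode _ _ _) v); lia.
rewrite mulrCA -exprnP; congr (_ * _).
have -> : (-1) ^+ k = (-1) ^+ (k - i) * (-1) ^+ i :> F by rewrite -exprD subnK.
rewrite -mulrA -expr2 -exprM mulnC exprM.
by rewrite sqrrN expr1n expr1n mulr1.
Qed.

Lemma mode_borcherds a b w :
  borcherds (mode : int -> gdual gr -> {linear _ -> _}) a b w.
Proof.
apply: (borcherds_identity charF (one := vac VC) (D := deriv_dual VC)).
- exact: mode0l.
- exact: mode_trunc.
- exact: mode_vacuum.
- exact: mode_creation_reg.
- exact: mode_creation_lim.
- exact: deriv_dual_vac.
- exact: deriv_dual_bracket.
- exact: mode_weak_comm.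
Qed.

End Pairing.

Lemma embed12B (F : fieldType) (W : lmodType F) (A : int * int -> W)
    m0 m1 m2 e0 e1 e2 : embed12 A ((m0, m1, m2) - (e0, e1, e2)) =
  if m0 - e0 == 0 then A (m1 - e1, m2 - e2) else 0.
Proof. by []. Qed.

Lemma embed02B (F : fieldType) (W : lmodType F) (A : int * int -> W)
    m0 m1 m2 e0 e1 e2 : embed02 A ((m0, m1, m2) - (e0, e1, e2)) =
  if m1 - e1 == 0 then A (m0 - e0, m2 - e2) else 0.
Proof. by []. Qed.

Section JacobiCoefficients.
Variables (F : fieldType) (V : lmodType F) (gr : int -> set V).
Hypothesis charF : [pchar F] =i pred0.
Variables (Y : {linear V -> (int -> tensor V V)}) (c : {linear V -> F^o}).
Hypothesis VC : graded_vertex_coalgebra_but_jacobi Y c gr.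
Local Notation mode := (mode VC).
Implicit Types (a b w : gdual gr) (v : V).

Lemma Y_right_trunc v : exists N : int, forall n1 n2, N < n1 ->
  Y_right Y v (n1, n2) = 0.
Proof.
have [N hN] := gvc_truncation VC v; exists N => n1 n2 Nn.
by rewrite /Y_right /Ycoef hN // !linear0.
Qed.

Lemma Y_right_flip_trunc v : exists N : int, forall n1 n2, N < n2 ->
  Y_right_flip Y v (n1, n2) = 0.
Proof.
have [N hN] := gvc_truncation VC v; exists N => n1 n2 Nn.
by rewrite /Y_right_flip /Ycoef hN // !linear0.
Qed.

Lemma Y_left_trunc v : exists N : int, forall n0 n2, N < n2 ->
  Y_left Y v (n0, n2) = 0.
Proof.
have [N hN] := gvc_truncation VC v; exists N => n0 n2 Nn.
by rewrite /Y_left /Ycoef hN // linear0.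
Qed.

(** In this and the next two lemmas x0^(m0) x1^(m1) x2^(m2) corresponds to
    (l,m,n) = (-m0-1, -m1-1, -m2-1), the exponents whose residue extracts that
    coefficient. *)
Lemma pair_jacobi_product a b w v m0 m1 m2 :
  tform3 a b w
    (cauchy_mul (delta_12_0 F) (embed12 (Y_right Y v)) (m0, m1, m2)) =
  product_sum (fun m n => mode m a (mode n b w))
    (- m0 - 1) (- m1 - 1) (- m2 - 1) v.
Proof.
have [N hN] := Y_right_trunc v.
rewrite eval_product_sum (@cauchy_mul_image _ _ _ _ _
  (fun i : nat => (m0, - m0 - 1 - i%:Z, i%:Z))); last 2 first.
- by move=> i j [].
- move=> [[e0 e1] e2] /sub_pow_neq0[i -> ->] /=.
  have [e0m _|_] := eqVneq (m0 - e0) 0; last by rewrite eqxx.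
  by exists i; congr (_, _, _); lia.
rewrite (@linear_finsum _ _ _ _ (absz (N - m0 - m1)%R).+1) => [|i Ni].
  apply: eq_finsum => i; have -> : delta_12_0 F (m0, - m0 - 1 - i%:Z, i%:Z) =
      gbinom F (- m0 - 1) i * (-1) ^+ i.
    rewrite /delta_12_0 /delta_sub sub_powE; last by lia.
    by rewrite (_ : - (m0 + 1) = - m0 - 1) 1?[LHS]mulrC //; lia.
  have -> : embed12 (Y_right Y v) ((m0, m1, m2) - (m0, - m0 - 1 - i%:Z, i%:Z)) =
      Y_right Y v (m1 - (- m0 - 1 - i%:Z), m2 - i%:Z).
    by rewrite embed12B subrr eqxx.
  rewrite linearZ (pair_Y_right VC).
  rewrite (_ : - (m1 - (- m0 - 1 - i%:Z)) - 1 =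
    - m1 - 1 + (- m0 - 1) - i%:Z); last by lia.
  by rewrite (_ : - (m2 - i%:Z) - 1 = - m2 - 1 + i%:Z) //; lia.
by rewrite embed12B hN ?if_same ?scaler0 //; lia.
Qed.

Lemma pair_jacobi_opposite a b w v m0 m1 m2 :
  tform3 a b w
    (cauchy_mul (delta_21_N0 F) (embed12 (Y_right_flip Y v)) (m0, m1, m2)) =
  opposite_sum (fun m n => mode n b (mode m a w))
    (- m0 - 1) (- m1 - 1) (- m2 - 1) v.
Proof.
have [N hN] := Y_right_flip_trunc v.
rewrite eval_opposite_sum (@cauchy_mul_image _ _ _ _ _
  (fun i : nat => (m0, i%:Z, - m0 - 1 - i%:Z))); last 2 first.
- by move=> i j [].
- move=> [[e0 e1] e2]; rewrite /= mulf_eq0 => /norP[_].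
  move=> /sub_pow_neq0[i -> ->] /=.
  have [e0m _|_] := eqVneq (m0 - e0) 0; last by rewrite eqxx.
  by exists i; congr (_, _, _); lia.
have h0 i : ((absz (N - m0 - m2)%R).+1 <= i)%N ->
  embed12 (Y_right_flip Y v) ((m0, m1, m2) - (m0, i%:Z, - m0 - 1 - i%:Z)) = 0.
  by move=> Ni; rewrite embed12B hN ?if_same //; lia.
rewrite (finsumE (N := (absz (N - m0 - m2)%R).+1)) => [|i /h0 ->];
  last exact: scaler0.
pose E i := tform3 a b w
  (embed12 (Y_right_flip Y v) ((m0, m1, m2) - (m0, i%:Z, - m0 - 1 - i%:Z))).
rewrite [X in _ = _ *: X](@eq_finsum _ _ _
    (fun i => (gbinom F (- m0 - 1) i * (-1) ^+ i) *: (E i : F^o))); last first.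
  move=> i; have -> : E i = tform3 a b w
      (Y_right_flip Y v (m1 - i%:Z, m2 - (- m0 - 1 - i%:Z))).
    by rewrite /E embed12B subrr eqxx.
  rewrite (pair_Y_right_flip VC).
  rewrite (_ : - (m2 - (- m0 - 1 - i%:Z)) - 1 =
    - m2 - 1 + (- m0 - 1) - i%:Z); last by lia.
  by rewrite (_ : - (m1 - i%:Z) - 1 = - m1 - 1 + i%:Z) //; lia.
rewrite (finsumE (N := (absz (N - m0 - m2)%R).+1)) => [|i /h0 Ei]; last first.
  by rewrite /E Ei linear0 scaler0.
rewrite linear_sum scaler_sumr; apply: eq_bigr => i _.
rewrite linearZ scalerA; congr (_ * _).
rewrite /delta_21_N0 /delta_subN sub_powE; last by lia.
rewrite [_ ^+ _ * _]mulrC (_ : - m0 - 1 = - (m0 + 1)); last by lia.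
by rewrite -exprz_inv invrN1.
Qed.

Lemma pair_jacobi_iterate a b w v m0 m1 m2 :
  tform3 a b w (cauchy_mul (delta_10_2 F) (embed02 (Y_left Y v)) (m0, m1, m2)) =
  iterate_sum (fun l n => mode n (mode l a b) w)
    (- m0 - 1) (- m1 - 1) (- m2 - 1) v.
Proof.
have [N hN] := Y_left_trunc v.
rewrite eval_iterate_sum (@cauchy_mul_image _ _ _ _ _
  (fun i : nat => (i%:Z, m1, - m1 - 1 - i%:Z))); last 2 first.
- by move=> i j [].
- move=> [[e0 e1] e2] /sub_pow_neq0[i -> e1E] /=.
  have [e1m _|_] := eqVneq (m1 - e1) 0; last by rewrite eqxx.
  by exists i; congr (_, _, _); lia.
rewrite (@linear_finsum _ _ _ _ (absz (N - m1 - m2)%R).+1) => [|i Ni].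
  apply: eq_finsum => i; have -> : delta_10_2 F (i%:Z, m1, - m1 - 1 - i%:Z) =
      gbinom F (- m1 - 1) i.
    rewrite /delta_10_2 /delta_sub sub_powE; last by lia.
    by rewrite -[RHS]gbinomN; congr (_ * gbinom F _ i); lia.
  have -> : embed02 (Y_left Y v) ((m0, m1, m2) - (i%:Z, m1, - m1 - 1 - i%:Z)) =
      Y_left Y v (m0 - i%:Z, m2 - (- m1 - 1 - i%:Z)).
    by rewrite embed02B subrr eqxx.
  rewrite linearZ (pair_Y_left VC).
  rewrite (_ : - (m2 - (- m1 - 1 - i%:Z)) - 1 =
    - m1 - 1 + (- m2 - 1) - i%:Z); last by lia.
  by rewrite (_ : - (m0 - i%:Z) - 1 = - m0 - 1 + i%:Z) //; lia.
by rewrite embed02B hN ?if_same ?scaler0 //; lia.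
Qed.

End JacobiCoefficients.

Theorem proposition3p2 (F : fieldType) (charF : [pchar F] =i pred0)
    (V : lmodType F) (gr : int -> set V)
    (Y : {linear V -> (int -> tensor V V)}) (c : {linear V -> F^o})
    (VC : graded_vertex_coalgebra_but_jacobi Y c gr)
    (WC : weak_cocommutativity Y gr)
    (DB : Dstar_bracket Y c) :
  jacobi_identity Y.
Proof.
move=> v; apply/funext => -[[m0 m1] m2].
apply/eqP; rewrite -subr_eq0; apply/eqP.
have sepV := graded_dual_separating (gvc_grading VC).
have jacobi0 (a b w : gdual gr) : tform3 a b w
    (cauchy_mul (delta_12_0 F) (embed12 (Y_right Y v)) (m0, m1, m2) -
     cauchy_mul (delta_21_N0 F) (embed12 (Y_right_flip Y v)) (m0, m1, m2) -
     cauchy_mul (delta_10_2 F) (embed02 (Y_left Y v)) (m0, m1, m2)) = 0.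
  rewrite !linearB /= (pair_jacobi_product VC) (pair_jacobi_opposite VC).
  rewrite (pair_jacobi_iterate VC) (mode_borcherds charF VC WC DB).
  by rewrite subrr.
apply: (separating_tensor (separating_tensor sepV sepV) sepV).
move=> _ [_ [f [[f1 [f2 [f1_gr f2_gr ->]]] f_gr ->]]].
exact: (jacobi0 (pack_gdual f1_gr) (pack_gdual f2_gr) (pack_gdual f_gr)).
Qed.
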